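(* Let $\mu\in\mathbb{R}$. There exist a real $2\times2$ matrix-valued function $A=A_\mu(x,y,t)$ on $\mathbb{T}^2\times\mathbb{R}^+$ in the regularity class $R(100,61)$ and a non-zero, uniformly $C^2$, real function $u=u_\mu$ on $\mathbb{T}^2\times\mathbb{R}^+$ such that $$\ddot u+\operatorname{div}(A\nabla u)=-\mu u\quad\text{in }\mathbb{T}^2\times\mathbb{R}^+,$$ and, for some constants $c(\mu),C(\mu)>0$ and all sufficiently large $T$, $\sup_{\mathbb{T}^2\times\{t\ge T\}}|u|\le Ce^{-ce^{cT}}$. Moreover, there is a positive integer $k$ with $|\mu|/k^2\le 1/1000$ such that on $\mathbb{T}^2\times[0,\tfrac1{100}]$, $$u(x,y,t)=\cos(kx)e^{-kt},\qquad A=\mathrm{Id}+\begin{pmatrix}\mu/k^2&0\\0&\mu/(4k^2)\end{pmatrix}.$$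
   Context: $\mathbb{T}^2=(\mathbb{R}/2\pi\mathbb{Z})^2$ with coordinates $(x,y)$; $t\ge0$ the third coordinate. For a real $2\times2$ matrix function $A(x,y,t)$, $\ddot u+\operatorname{div}(A\nabla u)$ means $\partial_t^2u+\sum_{i,j\in\{x,y\}}\partial_i(A_{ij}\partial_ju)$. Regularity class $R(\Lambda,C)$: $A$ satisfies $\Lambda^{-1}|\xi|^2\le\xi^TA\xi\le\Lambda|\xi|^2$ for all $\xi\in\mathbb{R}^2$ at every point, and the entries of $A$ are $C^1$ with all first partial derivatives (in $x,y,t$) bounded by $C$ in absolute value. Uniformly $C^2$: all partial derivatives of order $\le2$ are continuous and bounded. *)

(* Defs.v *)
From Stdlib Require Import Reals.
From Coquelicot Require Import Coquelicot.
Open Scope R_scope.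

(* Functions on T^2 x R^+ are represented as f : R -> R -> R -> R,
   f x y t, which are 2*pi-periodic in x and in y. *)
Definition periodic2 (f : R -> R -> R -> R) : Prop :=
  forall x y t, f (x + 2 * PI) y t = f x y t /\ f x (y + 2 * PI) t = f x y t.

Inductive coord := cx | cy | ct.

Definition Dp (i : coord) (f : R -> R -> R -> R) : R -> R -> R -> R :=
  fun x y t => match i with
  | cx => Derive (fun s => f s y t) x
  | cy => Derive (fun s => f x s t) y
  | ct => Derive (fun s => f x y s) t
  end.

Definition ex_Dp (i : coord) (f : R -> R -> R -> R) (x y t : R) : Prop :=
  match i with
  | cx => ex_derive (fun s => f s y t) x
  | cy => ex_derive (fun s => f x s t) y
  | ct => ex_derive (fun s => f x y s) t
  end.

Definition cont3 (f : R -> R -> R -> R) (x y t : R) : Prop :=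
  forall eps, 0 < eps -> exists delta, 0 < delta /\
    forall x' y' t', Rabs (x' - x) < delta -> Rabs (y' - y) < delta ->
      Rabs (t' - t) < delta -> Rabs (f x' y' t' - f x y t) < eps.

Definition C1_bounded (f : R -> R -> R -> R) (C : R) : Prop :=
  forall x y t, 0 < t ->
    cont3 f x y t /\
    forall i : coord, ex_Dp i f x y t /\ cont3 (Dp i f) x y t /\
                      Rabs (Dp i f x y t) <= C.

Definition uniformly_C2 (f : R -> R -> R -> R) : Prop :=
  exists M, forall x y t, 0 < t ->
    cont3 f x y t /\ Rabs (f x y t) <= M /\
    forall i : coord, ex_Dp i f x y t /\ cont3 (Dp i f) x y t /\
      Rabs (Dp i f x y t) <= M /\
      forall j : coord, ex_Dp j (Dp i f) x y t /\ cont3 (Dp j (Dp i f)) x y t /\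
        Rabs (Dp j (Dp i f) x y t) <= M.

(* A = [[a, b], [c, d]] (rows indexed by x, y) is in the regularity class
   R(Lam, C) on T^2 x R^+ *)
Definition reg_class (a b c d : R -> R -> R -> R) (Lam C : R) : Prop :=
  periodic2 a /\ periodic2 b /\ periodic2 c /\ periodic2 d /\
  (forall x y t, 0 <= t -> forall xi1 xi2,
     / Lam * (xi1 ^ 2 + xi2 ^ 2)
       <= xi1 * (a x y t * xi1 + b x y t * xi2) + xi2 * (c x y t * xi1 + d x y t * xi2)
     /\ xi1 * (a x y t * xi1 + b x y t * xi2) + xi2 * (c x y t * xi1 + d x y t * xi2)
       <= Lam * (xi1 ^ 2 + xi2 ^ 2)) /\
  C1_bounded a C /\ C1_bounded b C /\ C1_bounded c C /\ C1_bounded d C.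

Definition wave_op (a b c d u : R -> R -> R -> R) : R -> R -> R -> R :=
  fun x y t =>
    Dp ct (Dp ct u) x y t
    + Dp cx (fun x' y' t' => a x' y' t' * Dp cx u x' y' t' + b x' y' t' * Dp cy u x' y' t') x y t
    + Dp cy (fun x' y' t' => c x' y' t' * Dp cx u x' y' t' + d x' y' t' * Dp cy u x' y' t') x y t.

(* Main.v *)
Require Import Defs.
From Stdlib Require Import Reals Lra Lia ZArith FunctionalExtensionality.
From Coquelicot Require Import Coquelicot.
Open Scope R_scope.

(** The solution is a two-mode cascade. On a time step of fixed length a mode [cos (k x)] is
    replaced by [cos (2 k y)]; then the frequency doubles, [x] and [y] exchange roles, and the
    next step begins, so that after [n] steps the solution has size about [exp (- c 2^n)].

    Within a step the modes share one amplitude factor, whose decay rate is first accelerated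
    from [k] to [2 k] (by raising the entry [a] from 1 to 4): the ratio of the modes then stays
    bounded and they can be exchanged during a time of order 1.  Switching [cos (2 k y)] on with
    the profile [g] leaves an error [(g'' - 4 k g') cos (2 k y)].  It is the divergence of a field
    divisible by the [x]-derivative [- k sin (k x)] of the other mode, so it can be absorbed in
    the first column of [A], by a perturbation of size [O(1/k)] and frequency [k], whose
    derivatives are bounded uniformly in [k].  Switching [cos (k x)] off is absorbed likewise in
    the second column.  As [A] need not be symmetric, neither correction acts on the mode that
    is being switched. *)

(** * Separable functions: continuity and partial derivatives *)

Lemma continuous_cont3 (f : R -> R -> R -> R) (x y t : R) :
  continuous (fun p : R * (R * R) => f (fst p) (fst (snd p)) (snd (snd p)))
    (x, (y, t)) -> cont3 f x y t.
Proof.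
  intros H eps Heps.
  destruct (proj1 (filterlim_locally _ _) H (mkposreal eps Heps)) as [d Hd].
  exists d. split; [apply cond_pos|].
  intros x' y' t' Hx Hy Ht.
  apply (Hd (x', (y', t'))). repeat split; assumption.
Qed.

Lemma is_derive_eq (f : R -> R) (x l l' : R) :
  is_derive f x l -> l = l' -> is_derive f x l'.
Proof. intros H <-. exact H. Qed.

Lemma is_derive_Rplus (f g : R -> R) (x f' g' : R) :
  is_derive f x f' -> is_derive g x g' ->
  is_derive (fun s => f s + g s) x (f' + g').
Proof. exact (is_derive_plus f g x f' g'). Qed.

Lemma is_derive_Rmult (f g : R -> R) (x f' g' : R) :
  is_derive f x f' -> is_derive g x g' ->
  is_derive (fun s => f s * g s) x (f' * g x + f x * g').
Proof. intros Hf Hg. exact (is_derive_mult f g x f' g' Hf Hg Rmult_comm). Qed.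

Lemma is_derive_Rconst (c x : R) : is_derive (fun _ => c) x 0.
Proof. exact (is_derive_const c x). Qed.

Ltac derive_poly :=
  lazymatch goal with
  | |- is_derive (fun _ => ?c) _ _ => apply (is_derive_Rconst c)
  | |- is_derive (fun s => @?f s + @?g s) _ _ => apply (is_derive_Rplus f g); derive_poly
  | |- is_derive (fun s => @?f s * @?g s) _ _ => apply (is_derive_Rmult f g); derive_poly
  | |- _ => idtac
  end.

(* [p 0, ..., p N] are a C^N function and its derivatives. *)
Definition jets (N : nat) (p : nat -> R -> R) : Prop :=
  (forall i x, (i < N)%nat -> is_derive (p i) x (p (S i) x)) /\
  (forall i x, (i <= N)%nat -> continuous (p i) x).

(* With jets as arguments, the partial derivatives of a sum of two separable functions are
   obtained by shifting the indices [i], [j], [l]. *)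
Definition sep_sum (p1 q1 r1 p2 q2 r2 : nat -> R -> R) (i j l : nat) (x y t : R) : R :=
  p1 i x * q1 j y * r1 l t + p2 i x * q2 j y * r2 l t.

Definition sep_jets N (p1 q1 r1 p2 q2 r2 : nat -> R -> R) :=
  (jets N p1 /\ jets N q1 /\ jets N r1) /\ (jets N p2 /\ jets N q2 /\ jets N r2).

Lemma continuous_separable (p q r : R -> R) (x y t : R) :
  continuous p x -> continuous q y -> continuous r t ->
  continuous (fun w : R * (R * R) => p (fst w) * q (fst (snd w)) * r (snd (snd w)))
    (x, (y, t)).
Proof.
  intros Hp Hq Hr.
  apply (continuous_mult
    (fun w : R * (R * R) => p (fst w) * q (fst (snd w))) (fun w => r (snd (snd w)))).
  - apply (continuous_mult
      (fun w : R * (R * R) => p (fst w)) (fun w => q (fst (snd w)))).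
    + apply (continuous_comp (fun w : R * (R * R) => fst w) p); [apply continuous_fst|exact Hp].
    + apply (continuous_comp (fun w : R * (R * R) => fst (snd w)) q); [|exact Hq].
      apply (continuous_comp (fun w : R * (R * R) => snd w) (fun w => fst w));
        [apply continuous_snd|apply continuous_fst].
  - apply (continuous_comp (fun w : R * (R * R) => snd (snd w)) r); [|exact Hr].
    apply (continuous_comp (fun w : R * (R * R) => snd w) (fun w => snd w));
      apply continuous_snd.
Qed.

Lemma cont3_sep_sum N p1 q1 r1 p2 q2 r2 i j l x y t :
  sep_jets N p1 q1 r1 p2 q2 r2 -> (i <= N)%nat -> (j <= N)%nat -> (l <= N)%nat ->
  cont3 (sep_sum p1 q1 r1 p2 q2 r2 i j l) x y t.
Proof.
  intros [([_ Hp1] & [_ Hq1] & [_ Hr1]) ([_ Hp2] & [_ Hq2] & [_ Hr2])] Hi Hj Hl.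
  apply continuous_cont3. unfold sep_sum.
  apply (continuous_plus
    (fun w : R * (R * R) => p1 i (fst w) * q1 j (fst (snd w)) * r1 l (snd (snd w)))
    (fun w : R * (R * R) => p2 i (fst w) * q2 j (fst (snd w)) * r2 l (snd (snd w))));
  apply continuous_separable; auto.
Qed.

Definition is_Dp (c : coord) (f g : R -> R -> R -> R) : Prop :=
  forall x y t, match c with
  | cx => is_derive (fun s => f s y t) x (g x y t)
  | cy => is_derive (fun s => f x s t) y (g x y t)
  | ct => is_derive (fun s => f x y s) t (g x y t)
  end.

(** An equality of functions rather than of values, so that it can be rewritten inside a further
    derivative. *)
Lemma is_Dp_eq c f g : is_Dp c f g -> Dp c f = g.
Proof.
  intros H. do 3 (apply functional_extensionality; intro).
  destruct c; apply is_derive_unique, (H x x0 x1).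
Qed.

Lemma is_Dp_ex c f g x y t : is_Dp c f g -> ex_Dp c f x y t.
Proof. intros H. destruct c; exists (g x y t); apply (H x y t). Qed.

Lemma is_Dp_sep_sum N p1 q1 r1 p2 q2 r2 i j l c :
  sep_jets N p1 q1 r1 p2 q2 r2 -> (i + j + l < N)%nat ->
  is_Dp c (sep_sum p1 q1 r1 p2 q2 r2 i j l)
    (match c with
     | cx => sep_sum p1 q1 r1 p2 q2 r2 (S i) j l
     | cy => sep_sum p1 q1 r1 p2 q2 r2 i (S j) l
     | ct => sep_sum p1 q1 r1 p2 q2 r2 i j (S l)
     end).
Proof.
  intros [([Hp1 _] & [Hq1 _] & [Hr1 _]) ([Hp2 _] & [Hq2 _] & [Hr2 _])] H x y t.
  unfold sep_sum. destruct c; eapply is_derive_eq;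
    [ derive_poly; [apply Hp1; lia|apply Hp2; lia] | ring
    | derive_poly; [apply Hq1; lia|apply Hq2; lia] | ring
    | derive_poly; [apply Hr1; lia|apply Hr2; lia] | ring ].
Qed.

(** * Transfer of local properties between functions that agree on a time slab *)

(* Equality on a whole slab around time [t], so that it passes to all derivatives. *)
Definition near (f g : R -> R -> R -> R) (t : R) : Prop :=
  exists d, 0 < d /\ forall x y t', Rabs (t' - t) < d -> f x y t' = g x y t'.

Lemma near_eq f g t x y : near f g t -> f x y t = g x y t.
Proof.
  intros (d & Hd & H). apply H. rewrite Rminus_diag. rewrite Rabs_R0. exact Hd.
Qed.

Lemma slab_locally (P : R -> Prop) t t' d :
  Rabs (t' - t) < d -> (forall s, Rabs (s - t) < d -> P s) -> locally t' P.
Proof.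
  intros Ht H. assert (He : 0 < d - Rabs (t' - t)) by lra.
  exists (mkposreal _ He). intros s Hs.
  change (Rabs (s - t') < d - Rabs (t' - t)) in Hs.
  apply H. replace (s - t) with ((s - t') + (t' - t)) by ring.
  assert (B := Rabs_triang (s - t') (t' - t)). lra.
Qed.

(** Derivatives in [x] and [y] stay inside a time slice; only the [t]-derivative uses that the slab
    is open in time. *)
Lemma near_Dp c f g t : near f g t -> near (Dp c f) (Dp c g) t.
Proof.
  intros (d & Hd & H). exists d. split; [exact Hd|]. intros x y t' Ht'.
  destruct c; unfold Dp.
  - apply Derive_ext. intro s. apply H, Ht'.
  - apply Derive_ext. intro s. apply H, Ht'.
  - apply Derive_ext_loc. apply (slab_locally _ t _ d Ht'). intros s Hs. apply H, Hs.
Qed.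

Lemma near_ex_Dp c f g t x y : near f g t -> ex_Dp c g x y t -> ex_Dp c f x y t.
Proof.
  intros (d & Hd & H) Hg.
  assert (Ht : Rabs (t - t) < d) by (rewrite Rminus_diag, Rabs_R0; exact Hd).
  destruct c; simpl in *.
  - apply (ex_derive_ext (fun s => g s y t)); [|exact Hg].
    intro s. symmetry. apply H, Ht.
  - apply (ex_derive_ext (fun s => g x s t)); [|exact Hg].
    intro s. symmetry. apply H, Ht.
  - apply (ex_derive_ext_loc (fun s => g x y s)); [|exact Hg].
    apply (slab_locally _ t _ d Ht). intros s Hs. symmetry. apply H, Hs.
Qed.

Lemma near_cont3 f g t x y : near f g t -> cont3 g x y t -> cont3 f x y t.
Proof.
  intros (d & Hd & H) Hg eps Heps.
  destruct (Hg eps Heps) as (e & He & Hge).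
  exists (Rmin d e). split; [apply Rmin_pos; assumption|].
  intros x' y' t' Hx Hy Ht.
  assert (B1 := Rmin_l d e). assert (B2 := Rmin_r d e).
  rewrite (H x' y' t') by lra.
  rewrite (H x y t) by (rewrite Rminus_diag, Rabs_R0; exact Hd).
  apply Hge; lra.
Qed.

(** [wave_op] differentiates the products of matrix entries with the gradient, so these products too
    must agree on a slab. *)
Lemma near_flux a a' b b' f f' g g' t :
  near a a' t -> near b b' t -> near f f' t -> near g g' t ->
  near (fun x y t => a x y t * f x y t + b x y t * g x y t)
       (fun x y t => a' x y t * f' x y t + b' x y t * g' x y t) t.
Proof.
  intros (d1 & Hd1 & H1) (d2 & Hd2 & H2) (d3 & Hd3 & H3) (d4 & Hd4 & H4).
  exists (Rmin (Rmin d1 d2) (Rmin d3 d4)). split.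
  - repeat apply Rmin_pos; assumption.
  - intros x y t' Ht.
    apply Rmin_Rgt in Ht as [Ht Ht']. apply Rmin_Rgt in Ht as [? ?].
    apply Rmin_Rgt in Ht' as [? ?].
    rewrite H1, H2, H3, H4 by assumption. reflexivity.
Qed.

(** * Pointwise form of the requirements, its locality and its symmetry in [x] and [y] *)

Definition C1_at (f : R -> R -> R -> R) (C x y t : R) : Prop :=
  cont3 f x y t /\
  forall i, ex_Dp i f x y t /\ cont3 (Dp i f) x y t /\ Rabs (Dp i f x y t) <= C.

Definition C2_at (f : R -> R -> R -> R) (M x y t : R) : Prop :=
  cont3 f x y t /\ Rabs (f x y t) <= M /\
  forall i, ex_Dp i f x y t /\ cont3 (Dp i f) x y t /\ Rabs (Dp i f x y t) <= M /\
    forall j, ex_Dp j (Dp i f) x y t /\ cont3 (Dp j (Dp i f)) x y t /\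
      Rabs (Dp j (Dp i f) x y t) <= M.

Lemma C1_at_near f g C x y t : near f g t -> C1_at g C x y t -> C1_at f C x y t.
Proof.
  intros H [Hc Hd]. split; [apply (near_cont3 _ g); assumption|].
  intro i. destruct (Hd i) as (H1 & H2 & H3). assert (Hi := near_Dp i _ _ _ H).
  split; [apply (near_ex_Dp i _ g); assumption|].
  split; [apply (near_cont3 _ (Dp i g)); assumption|].
  rewrite (near_eq _ _ _ _ _ Hi). exact H3.
Qed.

Lemma C2_at_near f g C x y t : near f g t -> C2_at g C x y t -> C2_at f C x y t.
Proof.
  intros H (Hc & Hb & Hd). split; [apply (near_cont3 _ g); assumption|].
  split; [rewrite (near_eq _ _ _ _ _ H); exact Hb|].
  intro i. destruct (Hd i) as (H1 & H2 & H3 & H4). assert (Hi := near_Dp i _ _ _ H).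
  split; [apply (near_ex_Dp i _ g); assumption|].
  split; [apply (near_cont3 _ (Dp i g)); assumption|].
  split; [rewrite (near_eq _ _ _ _ _ Hi); exact H3|].
  apply (C1_at_near _ _ C x y t Hi (conj H2 H4)).
Qed.

Definition elliptic_at (a b c d : R -> R -> R -> R) (Lam x y t : R) : Prop :=
  forall xi1 xi2,
    / Lam * (xi1 ^ 2 + xi2 ^ 2)
      <= xi1 * (a x y t * xi1 + b x y t * xi2) + xi2 * (c x y t * xi1 + d x y t * xi2)
    /\ xi1 * (a x y t * xi1 + b x y t * xi2) + xi2 * (c x y t * xi1 + d x y t * xi2)
      <= Lam * (xi1 ^ 2 + xi2 ^ 2).

Definition solves_at (a b c d u : R -> R -> R -> R) (mu Lam C M t : R) : Prop :=
  forall x y,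
    elliptic_at a b c d Lam x y t /\
    C1_at a C x y t /\ C1_at b C x y t /\ C1_at c C x y t /\ C1_at d C x y t /\
    C2_at u M x y t /\ wave_op a b c d u x y t = - mu * u x y t.

Lemma solves_at_near a b c d u a' b' c' d' u' mu Lam C M t :
  near a a' t -> near b b' t -> near c c' t -> near d d' t -> near u u' t ->
  solves_at a' b' c' d' u' mu Lam C M t -> solves_at a b c d u mu Lam C M t.
Proof.
  intros Ha Hb Hc Hd Hu H x y.
  destruct (H x y) as (He & Ca & Cb & Cc & Cd & Cu & Hw).
  split.
  { intros xi1 xi2.
    rewrite (near_eq _ _ _ x y Ha), (near_eq _ _ _ x y Hb),
      (near_eq _ _ _ x y Hc), (near_eq _ _ _ x y Hd). apply He. }
  split; [apply (C1_at_near _ a'); assumption|].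
  split; [apply (C1_at_near _ b'); assumption|].
  split; [apply (C1_at_near _ c'); assumption|].
  split; [apply (C1_at_near _ d'); assumption|].
  split; [apply (C2_at_near _ u'); assumption|].
  unfold wave_op in *.
  rewrite (near_eq _ _ _ x y Hu), <- Hw.
  assert (Hux := near_Dp cx _ _ _ Hu). assert (Huy := near_Dp cy _ _ _ Hu).
  rewrite (near_eq _ _ _ x y (near_Dp ct _ _ _ (near_Dp ct _ _ _ Hu))).
  rewrite (near_eq _ _ _ x y (near_Dp cx _ _ _ (near_flux _ _ _ _ _ _ _ _ _ Ha Hb Hux Huy))).
  rewrite (near_eq _ _ _ x y (near_Dp cy _ _ _ (near_flux _ _ _ _ _ _ _ _ _ Hc Hd Hux Huy))).
  reflexivity.
Qed.

Definition swap (f : R -> R -> R -> R) : R -> R -> R -> R := fun x y t => f y x t.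

Lemma cont3_swap f x y t : cont3 f y x t -> cont3 (swap f) x y t.
Proof.
  intros H eps Heps. destruct (H eps Heps) as (d & Hd & Hf).
  exists d. split; [exact Hd|]. intros. apply Hf; assumption.
Qed.

Definition swapc (c : coord) := match c with cx => cy | cy => cx | ct => ct end.

Lemma Dp_swap c f : Dp c (swap f) = swap (Dp (swapc c) f).
Proof. destruct c; reflexivity. Qed.

Lemma ex_Dp_swap c f x y t : ex_Dp (swapc c) f y x t -> ex_Dp c (swap f) x y t.
Proof. destruct c; exact (fun h => h). Qed.

Lemma C1_at_swap f C x y t : C1_at f C y x t -> C1_at (swap f) C x y t.
Proof.
  intros [Hc Hd]. split; [apply cont3_swap; assumption|].
  intro i. destruct (Hd (swapc i)) as (H1 & H2 & H3).
  split; [apply ex_Dp_swap, H1|]. rewrite Dp_swap.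
  split; [apply cont3_swap, H2|exact H3].
Qed.

Lemma C2_at_swap f C x y t : C2_at f C y x t -> C2_at (swap f) C x y t.
Proof.
  intros (Hc & Hb & Hd). split; [apply cont3_swap; assumption|].
  split; [exact Hb|].
  intro i. destruct (Hd (swapc i)) as (H1 & H2 & H3 & H4).
  split; [apply ex_Dp_swap, H1|]. rewrite Dp_swap.
  split; [apply cont3_swap, H2|]. split; [exact H3|].
  apply (C1_at_swap (Dp (swapc i) f) C x y t (conj H2 H4)).
Qed.

(** Exchanging the coordinates conjugates the matrix by a permutation: the diagonal entries trade
    places, and so do the off-diagonal ones. *)
Lemma solves_at_swap a b c d u mu Lam C M t :
  solves_at a b c d u mu Lam C M t ->
  solves_at (swap d) (swap c) (swap b) (swap a) (swap u) mu Lam C M t.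
Proof.
  intros H x y. destruct (H y x) as (He & Ca & Cb & Cc & Cd & Cu & Hw).
  split.
  { intros xi1 xi2. destruct (He xi2 xi1) as [H1 H2]. unfold swap. split; lra. }
  do 4 (split; [apply C1_at_swap; assumption|]).
  split; [apply C2_at_swap; assumption|].
  unfold wave_op in *. change (swap u x y t) with (u y x t). rewrite <- Hw.
  rewrite !Dp_swap. simpl swapc.
  assert (E1 : forall F, Dp cx (swap F) x y t = Dp cy F y x t) by reflexivity.
  assert (E2 : forall F, Dp cy (swap F) x y t = Dp cx F y x t) by reflexivity.
  assert (L1 : (fun x' y' t' => swap d x' y' t' * swap (Dp cy u) x' y' t'
      + swap c x' y' t' * swap (Dp cx u) x' y' t')
    = swap (fun x' y' t' => c x' y' t' * Dp cx u x' y' t' + d x' y' t' * Dp cy u x' y' t')).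
  { do 3 (apply functional_extensionality; intro). unfold swap. ring. }
  assert (L2 : (fun x' y' t' => swap b x' y' t' * swap (Dp cy u) x' y' t'
      + swap a x' y' t' * swap (Dp cx u) x' y' t')
    = swap (fun x' y' t' => a x' y' t' * Dp cx u x' y' t' + b x' y' t' * Dp cy u x' y' t')).
  { do 3 (apply functional_extensionality; intro). unfold swap. ring. }
  rewrite L1, L2, E1, E2. unfold swap. ring.
Qed.

(** The product rule turns the operator into a polynomial in explicit derivatives, so that the
    equation becomes an algebraic identity. *)
Lemma wave_op_expand a b c d u ux uy ut utt uxx uxy uyx uyy ax bx cy' dy x y t :
  is_Dp cx u ux -> is_Dp cy u uy -> is_Dp ct u ut -> is_Dp ct ut utt ->
  is_Dp cx ux uxx -> is_Dp cy ux uxy -> is_Dp cx uy uyx -> is_Dp cy uy uyy ->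
  is_Dp cx a ax -> is_Dp cx b bx -> is_Dp cy c cy' -> is_Dp cy d dy ->
  wave_op a b c d u x y t =
    utt x y t + (ax x y t * ux x y t + a x y t * uxx x y t
                 + bx x y t * uy x y t + b x y t * uyx x y t)
    + (cy' x y t * ux x y t + c x y t * uxy x y t
       + dy x y t * uy x y t + d x y t * uyy x y t).
Proof.
  intros Hux Huy Hut Hutt Huxx Huxy Huyx Huyy Hax Hbx Hcy Hdy.
  unfold wave_op.
  rewrite (is_Dp_eq _ _ _ Hux), (is_Dp_eq _ _ _ Huy), (is_Dp_eq _ _ _ Hut),
    (is_Dp_eq _ _ _ Hutt).
  unfold Dp.
  specialize (Huxx x y t). specialize (Huxy x y t). specialize (Huyx x y t).
  specialize (Huyy x y t). specialize (Hax x y t). specialize (Hbx x y t).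
  specialize (Hcy x y t). specialize (Hdy x y t). cbv beta iota in *.
  f_equal; [f_equal|]; apply is_derive_unique;
    (eapply is_derive_eq;
      [derive_poly; eassumption|ring]).
Qed.

(** * A [C^3] ramp from 0 to 1 with an explicit primitive *)

Definition clamp (t : R) : R := Rmax 0 (Rmin 1 t).

Lemma clamp_low t : t <= 0 -> clamp t = 0.
Proof. intro. unfold clamp. rewrite Rmin_right, Rmax_left; lra. Qed.

Lemma clamp_high t : 1 <= t -> clamp t = 1.
Proof. intro. unfold clamp. rewrite Rmin_left, Rmax_right; lra. Qed.

Lemma clamp_mid t : 0 <= t <= 1 -> clamp t = t.
Proof. intro. unfold clamp. rewrite Rmin_right, Rmax_right; lra. Qed.

Lemma clamp_range t : 0 <= clamp t <= 1.
Proof.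
  destruct (Rle_dec t 0); [rewrite clamp_low; lra|].
  destruct (Rle_dec 1 t); [rewrite clamp_high|rewrite clamp_mid]; lra.
Qed.

Lemma clamp_lipschitz s t : Rabs (clamp s - clamp t) <= Rabs (s - t).
Proof.
  unfold clamp, Rmax, Rmin.
  repeat destruct Rle_dec; unfold Rabs; repeat destruct Rcase_abs; lra.
Qed.

Lemma continuous_clamp t : continuous clamp t.
Proof.
  apply filterlim_locally. intro eps. exists eps. intros s Hs.
  change (Rabs (s - t) < eps) in Hs. change (Rabs (clamp s - clamp t) < eps).
  assert (H := clamp_lipschitz s t). lra.
Qed.

(** Extends a function on [0, 1] by constants; the kinks of [clamp] do no harm because [P'] vanishes
    at both ends. *)
Lemma is_derive_clamp (P P' : R -> R) (t : R) :
  (forall x, is_derive P x (P' x)) -> P' 0 = 0 -> P' 1 = 0 ->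
  is_derive (fun s => P (clamp s)) t (P' (clamp t)).
Proof.
  intros HP H0 H1.
  (* Where [P'] is zero, the increment [e] of [clamp] satisfies [|e| <= |h|], so the difference
     quotient of the composition is bounded by that of [P]. This covers the endpoints and the
     constant regions together. *)
  assert (Hcrit : P' (clamp t) = 0 -> is_derive (fun s => P (clamp s)) t (P' (clamp t))).
  { intro Hz. rewrite Hz. apply is_derive_Reals. intros eps Heps.
    assert (HD := HP (clamp t)). rewrite Hz in HD. apply is_derive_Reals in HD.
    destruct (HD eps Heps) as [d Hd]. exists d. intros h Hh Hhd.
    assert (HL := clamp_lipschitz (t + h) t).
    replace (t + h - t) with h in HL by ring.
    set (e := clamp (t + h) - clamp t) in *.
    replace (clamp (t + h)) with (clamp t + e) by (unfold e; ring).
    destruct (Req_dec e 0) as [He|He].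
    - rewrite He, Rplus_0_r. replace ((P (clamp t) - P (clamp t)) / h - 0) with 0
        by (field; exact Hh). rewrite Rabs_R0. exact Heps.
    - assert (Hlt : Rabs e < d) by lra.
      specialize (Hd e He Hlt). rewrite Rminus_0_r in *.
      unfold Rdiv in *. rewrite Rabs_mult in *.
      rewrite Rabs_inv in *.
      assert (0 < Rabs e) by (apply Rabs_pos_lt; exact He).
      assert (0 < Rabs h) by (apply Rabs_pos_lt; exact Hh).
      apply (Rle_lt_trans _ (Rabs (P (clamp t + e) - P (clamp t)) * / Rabs e)); [|exact Hd].
      apply Rmult_le_compat_l; [apply Rabs_pos|].
      apply Rinv_le_contravar; assumption. }
  destruct (Rle_dec t 0) as [Hl|Hl]; [apply Hcrit; rewrite clamp_low; assumption|].
  destruct (Rle_dec 1 t) as [Hr|Hr]; [apply Hcrit; rewrite clamp_high; assumption|].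
  apply (is_derive_ext_loc P); [|rewrite clamp_mid by lra; apply HP].
  assert (Hd : 0 < Rmin t (1 - t)) by (apply Rmin_pos; lra).
  exists (mkposreal _ Hd). intros s Hs. change (Rabs (s - t) < Rmin t (1 - t)) in Hs.
  apply Rmin_Rgt in Hs as [Hs1 Hs2].
  rewrite clamp_mid; [reflexivity|].
  unfold Rabs in *; destruct Rcase_abs; lra.
Qed.

(* The primitive of 140 x^3 (1 - x)^3 vanishing at 0, followed by its derivatives. *)
Definition ramp_poly (j : nat) (x : R) : R :=
  match j with
  | 0%nat => 35 * x ^ 4 - 84 * x ^ 5 + 70 * x ^ 6 - 20 * x ^ 7
  | 1%nat => 140 * x ^ 3 * (1 - x) ^ 3
  | 2%nat => 420 * x ^ 2 * (1 - x) ^ 2 * (1 - 2 * x)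
  | _ => 840 * x * (1 - x) * (1 - 5 * x + 5 * x ^ 2)
  end.

Definition ramp (j : nat) (t : R) : R := ramp_poly j (clamp t).

Lemma is_derive_ramp_poly j x : (j < 3)%nat ->
  is_derive (ramp_poly j) x (ramp_poly (S j) x).
Proof.
  intro Hj. destruct j as [|[|[|j]]]; [| | |lia]; unfold ramp_poly; auto_derive; auto; ring.
Qed.

Lemma is_derive_ramp j t : (j < 3)%nat -> is_derive (ramp j) t (ramp (S j) t).
Proof.
  intro Hj. apply (is_derive_clamp (ramp_poly j) (ramp_poly (S j))).
  - intro x. apply is_derive_ramp_poly, Hj.
  - destruct j as [|[|j]]; simpl; ring.
  - destruct j as [|[|j]]; simpl; ring.
Qed.

Lemma continuous_ramp j t : continuous (ramp j) t.
Proof.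
  apply (continuous_comp clamp (ramp_poly j)); [apply continuous_clamp|].
  apply (ex_derive_continuous (ramp_poly j)). destruct j as [|[|[|j]]]; unfold ramp_poly; auto_derive; exact I.
Qed.

Lemma ramp_low j t : t <= 0 -> ramp j t = 0.
Proof.
  intro H. unfold ramp. rewrite clamp_low by assumption.
  destruct j as [|[|[|j]]]; simpl; ring.
Qed.

Lemma ramp_high j t : 1 <= t -> ramp j t = match j with 0%nat => 1 | _ => 0 end.
Proof.
  intro H. unfold ramp. rewrite clamp_high by assumption.
  destruct j as [|[|[|j]]]; simpl; ring.
Qed.

(** The substitution [x -> 1 - x] exchanges the polynomial with its complement to 1; each is a
    fourth power times a polynomial with positive coefficients in the other variable. *)
Lemma ramp0_range t : 0 <= ramp 0 t <= 1.
Proof.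
  unfold ramp. assert (H := clamp_range t). set (x := clamp t) in *. clearbody x. clear t.
  set (y := 1 - x). assert (Hy : 0 <= y) by (unfold y; lra).
  assert (H1 : 0 <= x) by lra.
  unfold ramp_poly. split.
  - replace (35 * x ^ 4 - 84 * x ^ 5 + 70 * x ^ 6 - 20 * x ^ 7)
      with (x ^ 4 * (1 + 4 * y + 10 * y ^ 2 + 20 * y ^ 3)) by (unfold y; ring).
    assert (0 <= y ^ 2) by (apply pow_le; lra). assert (0 <= y ^ 3) by (apply pow_le; lra).
    apply Rmult_le_pos; [apply pow_le|]; lra.
  - apply Rminus_le_0.
    replace (1 - (35 * x ^ 4 - 84 * x ^ 5 + 70 * x ^ 6 - 20 * x ^ 7))
      with (y ^ 4 * (1 + 4 * x + 10 * x ^ 2 + 20 * x ^ 3)) by (unfold y; ring).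
    assert (0 <= x ^ 2) by (apply pow_le; lra). assert (0 <= x ^ 3) by (apply pow_le; lra).
    apply Rmult_le_pos; [apply pow_le|]; lra.
Qed.

(** The derivatives are expressed through [x (1 - x)], which lies in [0, 1/4]. Crude constants
    suffice, since all frequencies will be at least 10000. *)
Lemma ramp_bound j t :
  Rabs (ramp j t) <= match j with 0%nat => 1 | 1%nat => 5 | 2%nat => 420 | _ => 10000 end.
Proof.
  destruct j as [|j].
  { assert (H := ramp0_range t). apply Rabs_le. lra. }
  unfold ramp. assert (H := clamp_range t). set (x := clamp t) in *. clearbody x. clear t.
  assert (Hsq := Rle_0_sqr (x - 1 / 2)). unfold Rsqr in Hsq.
  assert (Hz : 0 <= x * (1 - x) <= 1 / 4) by (split; nra).
  destruct j as [|[|j]]; unfold ramp_poly; cbv iota.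
  - replace (140 * x ^ 3 * (1 - x) ^ 3) with (140 * (x * (1 - x)) ^ 3) by ring.
    set (z := x * (1 - x)) in *.
    assert (0 <= z ^ 3) by (apply pow_le; lra).
    assert (z ^ 3 <= (1 / 4) ^ 3) by (apply pow_incr; lra).
    rewrite Rabs_right; lra.
  - replace (420 * x ^ 2 * (1 - x) ^ 2 * (1 - 2 * x))
      with (420 * (x * (1 - x)) ^ 2 * (1 - 2 * x)) by ring.
    set (z := x * (1 - x)) in *.
    assert (0 <= z ^ 2) by (apply pow_le; lra).
    assert (z ^ 2 <= (1 / 4) ^ 2) by (apply pow_incr; lra).
    apply Rabs_le. split; nra.
  - replace (840 * x * (1 - x) * (1 - 5 * x + 5 * x ^ 2))
      with (840 * (x * (1 - x)) * (1 - 5 * (x * (1 - x)))) by ring.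
    set (z := x * (1 - x)) in *.
    apply Rabs_le. split; nra.
Qed.

(* Integration by parts: the correction polynomial is the primitive of [x * ramp_poly 1 x]. *)
Definition ramp_int (t : R) : R :=
  t * ramp 0 t
  - (28 * clamp t ^ 5 - 70 * clamp t ^ 6 + 60 * clamp t ^ 7 - 35 / 2 * clamp t ^ 8).

Lemma is_derive_ramp_int t : is_derive ramp_int t (ramp 0 t).
Proof.
  set (Q := fun x => (-1) * (28 * x ^ 5 - 70 * x ^ 6 + 60 * x ^ 7 - 35 / 2 * x ^ 8)).
  apply (is_derive_ext (fun s => s * ramp 0 s + Q (clamp s))).
  { intro s. unfold ramp_int, Q. simpl. ring. }
  eapply is_derive_eq.
  - derive_poly; [apply (is_derive_id t)|apply (is_derive_ramp 0); lia|].
    apply (is_derive_clamp Q (fun x => - x * ramp_poly 1 x)).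
    + intro x. unfold Q. auto_derive; auto. simpl. field.
    + simpl. ring.
    + simpl. ring.
  (* The term [t * ramp 1 t] cancels the derivative of the correction: both vanish outside [0, 1],
     and inside [clamp t = t]. *)
  - unfold one; simpl. unfold ramp.
    destruct (Rle_dec t 0) as [Hl|Hl]; [rewrite clamp_low by assumption; simpl; ring|].
    destruct (Rle_dec 1 t) as [Hr|Hr]; [rewrite clamp_high by assumption; simpl; ring|].
    rewrite clamp_mid by lra. simpl. ring.
Qed.

Lemma ramp_int_low t : t <= 0 -> ramp_int t = 0.
Proof.
  intro H. unfold ramp_int. rewrite ramp_low, clamp_low by assumption. ring.
Qed.

(** The ramp has mean 1/2 on [0, 1]; this 1/2 reappears in the exponent lost per step. *)
Lemma ramp_int_high t : 1 <= t -> ramp_int t = t - 1 / 2.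
Proof.
  intro H. unfold ramp_int. rewrite ramp_high, clamp_high by assumption. field.
Qed.

Lemma ramp_int_ge0 t : 0 <= ramp_int t.
Proof.
  destruct (Rle_dec t 0) as [Hl|Hl]; [rewrite ramp_int_low; lra|].
  destruct (Rle_dec 1 t) as [Hr|Hr]; [rewrite ramp_int_high; lra|].
  unfold ramp_int, ramp. rewrite clamp_mid by lra. unfold ramp_poly.
  set (y := 1 - t). assert (Hy : 0 <= y) by (unfold y; lra).
  replace (t * (35 * t ^ 4 - 84 * t ^ 5 + 70 * t ^ 6 - 20 * t ^ 7) -
    (28 * t ^ 5 - 70 * t ^ 6 + 60 * t ^ 7 - 35 / 2 * t ^ 8))
    with (t ^ 5 * (1 / 2 + 3 / 2 * y + 5 / 2 * y ^ 2 + 5 / 2 * y ^ 3)) by (unfold y; field).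
  assert (0 <= y ^ 2) by (apply pow_le; lra). assert (0 <= y ^ 3) by (apply pow_le; lra).
  apply Rmult_le_pos; [apply pow_le|]; lra.
Qed.

(** * Regularity and bounds for separable sums; jets of the trigonometric modes *)

Lemma jets_intro N p :
  (forall i x, (i < N)%nat -> is_derive (p i) x (p (S i) x)) ->
  (forall x, continuous (p N) x) -> jets N p.
Proof.
  intros HD HC. split; [exact HD|]. intros i x Hi.
  destruct (Nat.eq_dec i N) as [->|Hne]; [apply HC|].
  apply (ex_derive_continuous (p i)). exists (p (S i) x). apply HD. lia.
Qed.

Lemma C1_at_sep_sum p1 q1 r1 p2 q2 r2 C x y t :
  sep_jets 1 p1 q1 r1 p2 q2 r2 ->
  Rabs (sep_sum p1 q1 r1 p2 q2 r2 1 0 0 x y t) <= C ->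
  Rabs (sep_sum p1 q1 r1 p2 q2 r2 0 1 0 x y t) <= C ->
  Rabs (sep_sum p1 q1 r1 p2 q2 r2 0 0 1 x y t) <= C ->
  C1_at (sep_sum p1 q1 r1 p2 q2 r2 0 0 0) C x y t.
Proof.
  intros HJ Hx Hy Ht.
  split; [apply (cont3_sep_sum 1); auto|].
  intro c. assert (HD := is_Dp_sep_sum 1 p1 q1 r1 p2 q2 r2 0 0 0 c HJ ltac:(lia)).
  split; [exact (is_Dp_ex _ _ _ _ _ _ HD)|]. rewrite (is_Dp_eq _ _ _ HD).
  destruct c; (split; [apply (cont3_sep_sum 1); auto|assumption]).
Qed.

Lemma C2_at_sep_sum p1 q1 r1 p2 q2 r2 M x y t :
  sep_jets 2 p1 q1 r1 p2 q2 r2 ->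
  (forall i j l, (i + j + l <= 2)%nat -> Rabs (sep_sum p1 q1 r1 p2 q2 r2 i j l x y t) <= M) ->
  C2_at (sep_sum p1 q1 r1 p2 q2 r2 0 0 0) M x y t.
Proof.
  intros HJ HM.
  split; [apply (cont3_sep_sum 2); auto|]. split; [apply HM; lia|].
  intro c. assert (HD := is_Dp_sep_sum 2 p1 q1 r1 p2 q2 r2 0 0 0 c HJ ltac:(lia)).
  split; [exact (is_Dp_ex _ _ _ _ _ _ HD)|]. rewrite (is_Dp_eq _ _ _ HD). clear HD.
  destruct c; (split; [apply (cont3_sep_sum 2); auto|split; [apply HM; lia|]]); intro c';
  match goal with |- ex_Dp _ (sep_sum _ _ _ _ _ _ ?i ?j ?l) _ _ _ /\ _ =>
    assert (HD := is_Dp_sep_sum 2 p1 q1 r1 p2 q2 r2 i j l c' HJ ltac:(lia)) end;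
  (split; [exact (is_Dp_ex _ _ _ _ _ _ HD)|]); rewrite (is_Dp_eq _ _ _ HD);
  destruct c'; (split; [apply (cont3_sep_sum 2); auto|apply HM; lia]).
Qed.

Lemma Rabs_mult_le x y a b : Rabs x <= a -> Rabs y <= b -> Rabs (x * y) <= a * b.
Proof.
  intros Hx Hy. rewrite Rabs_mult.
  apply Rmult_le_compat; auto using Rabs_pos.
Qed.

Lemma sep_sum_bound p1 q1 r1 p2 q2 r2 i j l x y t a1 b1 c1 a2 b2 c2 :
  Rabs (p1 i x) <= a1 -> Rabs (q1 j y) <= b1 -> Rabs (r1 l t) <= c1 ->
  Rabs (p2 i x) <= a2 -> Rabs (q2 j y) <= b2 -> Rabs (r2 l t) <= c2 ->
  Rabs (sep_sum p1 q1 r1 p2 q2 r2 i j l x y t) <= a1 * b1 * c1 + a2 * b2 * c2.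
Proof.
  intros. unfold sep_sum. eapply Rle_trans; [apply Rabs_triang|].
  apply Rplus_le_compat; repeat apply Rabs_mult_le; assumption.
Qed.

Definition const_jet (c : R) (j : nat) (x : R) : R := match j with 0%nat => c | _ => 0 end.

Definition cos_jet (k : R) (j : nat) (x : R) : R :=
  match j with
  | 0%nat => cos (k * x)
  | 1%nat => - k * sin (k * x)
  | _ => - k ^ 2 * cos (k * x)
  end.

Definition sin_jet (k : R) (j : nat) (x : R) : R :=
  match j with
  | 0%nat => sin (k * x)
  | 1%nat => k * cos (k * x)
  | _ => - k ^ 2 * sin (k * x)
  end.

Lemma jets_const N c : jets N (const_jet c).
Proof.
  apply jets_intro.
  - intros i x _. destruct i; simpl; apply (is_derive_Rconst _ x).
  - intro x. destruct N; apply continuous_const.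
Qed.

Lemma jets_cos N k : (N <= 2)%nat -> jets N (cos_jet k).
Proof.
  intro HN. apply jets_intro.
  - intros i x Hi. destruct i as [|[|i]]; [| |lia]; unfold cos_jet; auto_derive; auto; simpl; ring.
  - intro x. apply (ex_derive_continuous (cos_jet k N)).
    destruct N as [|[|N]]; unfold cos_jet; auto_derive; exact I.
Qed.

Lemma jets_sin N k : (N <= 2)%nat -> jets N (sin_jet k).
Proof.
  intro HN. apply jets_intro.
  - intros i x Hi. destruct i as [|[|i]]; [| |lia]; unfold sin_jet; auto_derive; auto; simpl; ring.
  - intro x. apply (ex_derive_continuous (sin_jet k N)).
    destruct N as [|[|N]]; unfold sin_jet; auto_derive; exact I.
Qed.

Lemma Rabs_sin_le z : Rabs (sin z) <= 1.
Proof. apply Rabs_le, SIN_bound. Qed.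

Lemma Rabs_cos_le z : Rabs (cos z) <= 1.
Proof. apply Rabs_le, COS_bound. Qed.

Lemma cos_jet_bound k j x : 0 <= k -> (j <= 2)%nat -> Rabs (cos_jet k j x) <= k ^ j.
Proof.
  intros Hk Hj. rewrite <- (Rmult_1_r (k ^ j)).
  destruct j as [|[|[|j]]]; [| | |lia]; simpl cos_jet.
  - rewrite Rmult_1_r. apply Rabs_cos_le.
  - apply Rabs_mult_le; [|apply Rabs_sin_le]. rewrite Rabs_Ropp, Rabs_pos_eq; simpl; lra.
  - apply Rabs_mult_le; [|apply Rabs_cos_le]. rewrite Rabs_Ropp, Rabs_pos_eq; simpl; nra.
Qed.

Lemma sin_jet_bound k j x : 0 <= k -> (j <= 2)%nat -> Rabs (sin_jet k j x) <= k ^ j.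
Proof.
  intros Hk Hj. rewrite <- (Rmult_1_r (k ^ j)).
  destruct j as [|[|[|j]]]; [| | |lia]; simpl sin_jet.
  - rewrite Rmult_1_r. apply Rabs_sin_le.
  - apply Rabs_mult_le; [|apply Rabs_cos_le]. rewrite Rabs_pos_eq; simpl; lra.
  - apply Rabs_mult_le; [|apply Rabs_sin_le]. rewrite Rabs_Ropp, Rabs_pos_eq; simpl; nra.
Qed.

(** * Time profiles of a step *)

Definition ramp_from (c : R) (j : nat) (t : R) : R := ramp j (t - c).

Lemma is_derive_ramp_from c j t : (j < 3)%nat -> is_derive (ramp_from c j) t (ramp_from c (S j) t).
Proof.
  intro Hj. unfold ramp_from.
  eapply is_derive_eq.
  - apply (is_derive_comp (ramp j) (fun s => s - c)).
    + apply is_derive_ramp, Hj.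
    + auto_derive; [exact I|reflexivity].
  - unfold scal; simpl; unfold mult; simpl. ring.
Qed.

Lemma continuous_ramp_from c j t : continuous (ramp_from c j) t.
Proof.
  apply (continuous_comp (fun s => s - c) (ramp j)); [|apply continuous_ramp].
  apply (ex_derive_continuous (fun s => s - c)). auto_derive. exact I.
Qed.

Lemma continuous_Rmult (f g : R -> R) x :
  continuous f x -> continuous g x -> continuous (fun s => f s * g s) x.
Proof. exact (continuous_mult f g x). Qed.

Lemma continuous_Rplus (f g : R -> R) x :
  continuous f x -> continuous g x -> continuous (fun s => f s + g s) x.
Proof. exact (continuous_plus f g x). Qed.

(* A step occupies times [tau, tau + 6]: the rate is accelerated in [tau + 1, tau + 2], the
   [y]-mode rises in [tau + 2, tau + 3], the [x]-mode fades in [tau + 3, tau + 4], and the entry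
   [a] is reset to the value required by the next step in [tau + 4, tau + 5]. *)
Definition rate (tau : R) (j : nat) (t : R) : R := const_jet 1 j t + ramp_from (tau + 1) j t.
Definition fade (tau : R) (j : nat) (t : R) : R := const_jet 1 j t + -1 * ramp_from (tau + 3) j t.
Definition rise (tau : R) (j : nat) (t : R) : R := ramp_from (tau + 2) j t.

(** The exponent is [m], the loss accumulated in earlier steps, plus [k] times the integral of
    [rate] from [tau] to [t]. *)
Definition damp (k m tau t : R) : R :=
  exp (- (m + k * (t - tau + ramp_int (t - (tau + 1))))).

(** The time derivatives of [damp * f 0], with [damp] factored out by means of
    [damp' = - k * rate * damp]. *)
Definition amp (k m tau : R) (f : nat -> R -> R) (j : nat) (t : R) : R :=
  damp k m tau t *
  match j with
  | 0%nat => f 0%nat t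
  | 1%nat => f 1%nat t + - k * rate tau 0 t * f 0%nat t
  | _ => f 2%nat t + - k * rate tau 1 t * f 0%nat t
         + -2 * k * rate tau 0 t * f 1%nat t + k ^ 2 * (rate tau 0 t * rate tau 0 t) * f 0%nat t
  end.

(* While the [x]-mode is present, [k^2 a = rate^2 k^2 - rate' k + mu], so that
   [cos (k x) * damp] is a solution. The last term leads from [4 + mu/k^2] to [1 + mu/(4 k)^2]. *)
Definition base (k mu tau : R) (j : nat) (t : R) : R :=
  match j with
  | 0%nat => rate tau 0 t * rate tau 0 t + - / k * rate tau 1 t + mu / k ^ 2
             + - (3 + 15 / 16 * (mu / k ^ 2)) * ramp_from (tau + 4) 0 t
  | _ => 2 * (rate tau 0 t * rate tau 1 t) + - / k * rate tau 2 t
         + - (3 + 15 / 16 * (mu / k ^ 2)) * ramp_from (tau + 4) 1 t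
  end.

(** At rate 2, [(g damp)'' - 4 k^2 g damp = (g'' - 4 k g') damp], which is the error to be
    cancelled. The factor [e] is negative for [rise] and positive for [fade], the latter being 1
    minus a ramp. *)
Definition pert (k c e : R) (j : nat) (t : R) : R :=
  e * (4 * k * ramp_from c (1 + j) t + -1 * ramp_from c (2 + j) t).

Lemma is_derive_rate tau j t : (j < 3)%nat -> is_derive (rate tau j) t (rate tau (S j) t).
Proof.
  intro Hj. unfold rate. apply (is_derive_Rplus (const_jet 1 j)).
  - apply (proj1 (jets_const (S j) 1)). lia.
  - apply is_derive_ramp_from, Hj.
Qed.

Lemma is_derive_fade tau j t : (j < 3)%nat -> is_derive (fade tau j) t (fade tau (S j) t).
Proof.
  intro Hj. unfold fade. apply (is_derive_Rplus (const_jet 1 j)).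
  - apply (proj1 (jets_const (S j) 1)). lia.
  - apply is_derive_scal, is_derive_ramp_from, Hj.
Qed.

Lemma is_derive_rise tau j t : (j < 3)%nat -> is_derive (rise tau j) t (rise tau (S j) t).
Proof. apply is_derive_ramp_from. Qed.

Lemma is_derive_damp k m tau t :
  is_derive (damp k m tau) t (damp k m tau t * (- k * rate tau 0 t)).
Proof.
  unfold damp.
  assert (HI : is_derive (fun s => ramp_int (s - (tau + 1))) t (ramp_from (tau + 1) 0 t)).
  { eapply is_derive_eq.
    - apply (is_derive_comp ramp_int (fun s => s - (tau + 1))).
      + apply is_derive_ramp_int.
      + auto_derive; [exact I|reflexivity].
    - unfold scal; simpl; unfold mult; simpl. unfold ramp_from. ring. }
  eapply is_derive_eq.
  - apply (is_derive_comp exp (fun s => - (m + k * (s - tau + ramp_int (s - (tau + 1)))))).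
    + apply is_derive_exp.
    + apply (is_derive_ext (fun s => - m + - k * ((s + - tau) + ramp_int (s - (tau + 1))))).
      { intro s. simpl. ring. }
      derive_poly; [|exact HI]. apply is_derive_id.
  - unfold scal; simpl; unfold mult, one; simpl. unfold rate. simpl. ring.
Qed.

Lemma is_derive_continuous (f : R -> R) x l : is_derive f x l -> continuous f x.
Proof. intro H. apply (ex_derive_continuous f). exists l. exact H. Qed.

Ltac continuous_poly :=
  lazymatch goal with
  | |- continuous (fun _ => ?c) _ => apply continuous_const
  | |- continuous (fun s => @?f s + @?g s) _ => apply (continuous_Rplus f g); continuous_poly
  | |- continuous (fun s => @?f s * @?g s) _ => apply (continuous_Rmult f g); continuous_poly
  | |- _ => idtac
  end.

Local Opaque is_derive continuous.

Lemma jets_amp k m tau f : jets 2 f -> jets 2 (amp k m tau f).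
Proof.
  intros [HD HC].
  assert (D0 := fun t => HD 0%nat t ltac:(lia)). assert (D1 := fun t => HD 1%nat t ltac:(lia)).
  assert (R0 := fun t => is_derive_rate tau 0 t ltac:(lia)).
  assert (R1 := fun t => is_derive_rate tau 1 t ltac:(lia)).
  assert (Dd := is_derive_damp k m tau).
  unfold amp. set (E := damp k m tau) in *. set (r := rate tau) in *. clearbody E r.
  apply jets_intro.
  - intros i t Hi. destruct i as [|[|i]]; [| |lia]; cbv iota;
      (eapply is_derive_eq; [derive_poly; first [apply Dd|apply D0|apply D1|apply R0]|]).
    + simpl. ring.
    + simpl. ring.
  - intro t. cbv iota. continuous_poly;
    first [ exact (is_derive_continuous _ _ _ (Dd t)) | exact (is_derive_continuous _ _ _ (D0 t))
          | exact (is_derive_continuous _ _ _ (D1 t)) | exact (is_derive_continuous _ _ _ (R0 t))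
          | exact (is_derive_continuous _ _ _ (R1 t)) | apply HC; lia ].
Qed.

Lemma jets_fade tau : jets 2 (fade tau).
Proof.
  apply jets_intro.
  - intros. apply is_derive_fade. lia.
  - intro x. exact (is_derive_continuous _ _ _ (is_derive_fade tau 2 x ltac:(lia))).
Qed.

Lemma jets_rise tau : jets 2 (rise tau).
Proof.
  apply jets_intro.
  - intros. apply is_derive_rise. lia.
  - intro x. exact (is_derive_continuous _ _ _ (is_derive_rise tau 2 x ltac:(lia))).
Qed.

Lemma jets_base k mu tau : jets 1 (base k mu tau).
Proof.
  assert (R0 := fun t => is_derive_rate tau 0 t ltac:(lia)).
  assert (R1 := fun t => is_derive_rate tau 1 t ltac:(lia)).
  assert (R2 := fun t => is_derive_rate tau 2 t ltac:(lia)).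
  assert (P0 := fun t => is_derive_ramp_from (tau + 4) 0 t ltac:(lia)).
  assert (P1 := continuous_ramp_from (tau + 4) 1).
  unfold base. set (r := rate tau) in *. set (p := ramp_from (tau + 4)) in *. clearbody r p.
  apply jets_intro.
  - intros i t Hi. destruct i as [|i]; [|lia]. cbv iota.
    eapply is_derive_eq; [derive_poly; first [apply R0|apply R1|apply P0]|]. ring.
  - intro t. cbv iota. continuous_poly;
    first [ exact (is_derive_continuous _ _ _ (R0 t)) | exact (is_derive_continuous _ _ _ (R1 t))
          | exact (is_derive_continuous _ _ _ (R2 t)) | exact (is_derive_continuous _ _ _ (P0 t)) | apply P1 ].
Qed.

(** The second derivative of the profile enters the matrix, so [C^1] entries require a [C^3]
    ramp. *)
Lemma jets_pert k c e : jets 1 (pert k c e).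
Proof.
  apply jets_intro.
  - intros i t Hi. destruct i as [|i]; [|lia]. unfold pert.
    eapply is_derive_eq; [derive_poly; apply is_derive_ramp_from; lia|]. simpl. ring.
  - intro t. unfold pert. continuous_poly; apply continuous_ramp_from.
Qed.

(** * The matrix and the solution in one step *)

(* The first column of the perturbation is, up to the time factor, the field
   [(cos (2ky) sin (kx) cos (kx), sin (2ky) sin^2 (kx)) / k], of divergence [cos (2ky)], divided
   by [- k sin (kx)]; the second one is the field
   [(2 sin (kx) sin^2 (2ky), cos (kx) sin (2ky) cos (2ky) / 2) / k], of divergence [cos (kx)],
   divided by [- 2 k sin (2ky)]. *)
Definition step_u (k m tau : R) : nat -> nat -> nat -> R -> R -> R -> R :=
  sep_sum (cos_jet k) (const_jet 1) (amp k m tau (fade tau)) (const_jet 1) (cos_jet (2 * k)) (amp k m tau (rise tau)).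
Definition step_a (k mu tau : R) : nat -> nat -> nat -> R -> R -> R -> R :=
  sep_sum (const_jet 1) (const_jet 1) (base k mu tau) (cos_jet k) (cos_jet (2 * k)) (pert k (tau + 2) (- / k ^ 2)).
Definition step_b (k tau : R) : nat -> nat -> nat -> R -> R -> R -> R :=
  sep_sum (const_jet 0) (const_jet 0) (const_jet 0) (sin_jet k) (sin_jet (2 * k)) (pert k (tau + 3) (/ k ^ 2)).
Definition step_c (k tau : R) : nat -> nat -> nat -> R -> R -> R -> R :=
  sep_sum (const_jet 0) (const_jet 0) (const_jet 0) (sin_jet k) (sin_jet (2 * k)) (pert k (tau + 2) (- / k ^ 2)).
Definition step_d (k mu tau : R) : nat -> nat -> nat -> R -> R -> R -> R :=
  sep_sum (const_jet 1) (const_jet 1) (const_jet (1 + mu / (4 * k ^ 2)))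
    (cos_jet k) (cos_jet (2 * k)) (pert k (tau + 3) (/ (4 * k ^ 2))).

Lemma sep_jets_u k m tau : sep_jets 2 (cos_jet k) (const_jet 1) (amp k m tau (fade tau))
  (const_jet 1) (cos_jet (2 * k)) (amp k m tau (rise tau)).
Proof.
  split; (split; [|split]).
  - apply jets_cos. lia.
  - apply jets_const.
  - apply jets_amp, jets_fade.
  - apply jets_const.
  - apply jets_cos. lia.
  - apply jets_amp, jets_rise.
Qed.

Lemma sep_jets_pert k r c e (q : R -> nat -> R -> R) c0 :
  (forall k, jets 1 (q k)) -> jets 1 r ->
  sep_jets 1 (const_jet c0) (const_jet c0) r (q k) (q (2 * k)) (pert k c e).
Proof.
  intros Hq Hr.
  split; (split; [|split]).
  - apply jets_const.
  - apply jets_const.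
  - exact Hr.
  - apply Hq.
  - apply Hq.
  - apply jets_pert.
Qed.

(** At any time at most one of the four ramps is moving and the others are constantly 0 or 1. In
    each of the four cases the equation is a rational identity modulo [sin^2 + cos^2 = 1]. *)
Lemma step_equation k m tau mu x y t : 0 < k ->
  wave_op (step_a k mu tau 0 0 0) (step_b k tau 0 0 0) (step_c k tau 0 0 0)
    (step_d k mu tau 0 0 0) (step_u k m tau 0 0 0) x y t
  = - mu * step_u k m tau 0 0 0 x y t.
Proof.
  intros Hk.
  assert (HU := sep_jets_u k m tau).
  assert (Hc : forall k, jets 1 (cos_jet k)) by (intro; apply jets_cos; lia).
  assert (Hs : forall k, jets 1 (sin_jet k)) by (intro; apply jets_sin; lia).
  assert (HA := sep_jets_pert k (base k mu tau) (tau + 2) (- / k ^ 2) cos_jet 1 Hc (jets_base _ _ _)).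
  assert (HB := sep_jets_pert k (const_jet 0) (tau + 3) (/ k ^ 2) sin_jet 0 Hs (jets_const _ _)).
  assert (HC := sep_jets_pert k (const_jet 0) (tau + 2) (- / k ^ 2) sin_jet 0 Hs (jets_const _ _)).
  assert (HD := sep_jets_pert k (const_jet (1 + mu / (4 * k ^ 2))) (tau + 3) (/ (4 * k ^ 2)) cos_jet 1 Hc
    (jets_const _ _)).
  unfold step_a, step_b, step_c, step_d, step_u.
  rewrite (wave_op_expand _ _ _ _ _ _ _ _ _ _ _ _ _ _ _ _ _ x y t
    (is_Dp_sep_sum 2 _ _ _ _ _ _ 0 0 0 cx HU ltac:(lia)) (is_Dp_sep_sum 2 _ _ _ _ _ _ 0 0 0 cy HU ltac:(lia))
    (is_Dp_sep_sum 2 _ _ _ _ _ _ 0 0 0 ct HU ltac:(lia)) (is_Dp_sep_sum 2 _ _ _ _ _ _ 0 0 1 ct HU ltac:(lia))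
    (is_Dp_sep_sum 2 _ _ _ _ _ _ 1 0 0 cx HU ltac:(lia)) (is_Dp_sep_sum 2 _ _ _ _ _ _ 1 0 0 cy HU ltac:(lia))
    (is_Dp_sep_sum 2 _ _ _ _ _ _ 0 1 0 cx HU ltac:(lia)) (is_Dp_sep_sum 2 _ _ _ _ _ _ 0 1 0 cy HU ltac:(lia))
    (is_Dp_sep_sum 1 _ _ _ _ _ _ 0 0 0 cx HA ltac:(lia)) (is_Dp_sep_sum 1 _ _ _ _ _ _ 0 0 0 cx HB ltac:(lia))
    (is_Dp_sep_sum 1 _ _ _ _ _ _ 0 0 0 cy HC ltac:(lia)) (is_Dp_sep_sum 1 _ _ _ _ _ _ 0 0 0 cy HD ltac:(lia))).
  clear HU HA HB HC HD Hc Hs.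
  unfold sep_sum, amp, base, pert, fade, rise, rate, cos_jet, sin_jet, const_jet, ramp_from.
  assert (Px := sin2_cos2 (k * x)). assert (Py := sin2_cos2 (2 * k * y)).
  unfold Rsqr in *.
  set (E := damp k m tau t).
  set (cx0 := cos (k * x)) in *. set (sx := sin (k * x)) in *.
  set (cy0 := cos (2 * k * y)) in *. set (sy := sin (2 * k * y)) in *.
  clearbody E cx0 sx cy0 sy.
  assert (Px' : sx ^ 2 = 1 - cx0 ^ 2) by (simpl; lra).
  assert (Py' : sy ^ 2 = 1 - cy0 ^ 2) by (simpl; lra).
  assert (Hk0 : k <> 0) by lra.
  simpl Nat.add.
  destruct (Rle_dec t (tau + 2)) as [H2|H2];
    [|destruct (Rle_dec t (tau + 3)) as [H3|H3];
      [|destruct (Rle_dec t (tau + 4)) as [H4|H4]]].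
  (* Acceleration: only the [x]-mode is present, and [base] was chosen to solve its equation. *)
  - rewrite !(ramp_low _ (t - (tau + 2))), !(ramp_low _ (t - (tau + 3))),
      !(ramp_low _ (t - (tau + 4))) by lra.
    field [Px' Py']. exact Hk0.
  (* Rise of the [y]-mode, with [fade = 1] and rate 2: the first column absorbs the error. *)
  - rewrite !(ramp_high _ (t - (tau + 1))), !(ramp_low _ (t - (tau + 3))),
      !(ramp_low _ (t - (tau + 4))) by lra.
    field [Px' Py']. exact Hk0.
  (* Fading of the [x]-mode, with [rise = 1]: the second column absorbs the error. *)
  - rewrite !(ramp_high _ (t - (tau + 1))), !(ramp_high _ (t - (tau + 2))),
      !(ramp_low _ (t - (tau + 4))) by lra.
    field [Px' Py']. exact Hk0.
  (* Only the [y]-mode is left, so the [x]-derivative of the solution is zero and the entry [a] can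
     move freely. *)
  - rewrite !(ramp_high _ (t - (tau + 1))), !(ramp_high _ (t - (tau + 2))),
      !(ramp_high _ (t - (tau + 3))) by lra.
    field [Px' Py']. exact Hk0.
Qed.

(** * Bounds and ellipticity within a step *)

Lemma Rabs_plus_le x y a b : Rabs x <= a -> Rabs y <= b -> Rabs (x + y) <= a + b.
Proof. intros. eapply Rle_trans; [apply Rabs_triang|]. lra. Qed.

Lemma Rabs_opp_le x a : Rabs x <= a -> Rabs (- x) <= a.
Proof. now rewrite Rabs_Ropp. Qed.

Lemma Rabs_const_le x : 0 <= x -> Rabs x <= x.
Proof. intro H. rewrite Rabs_pos_eq; lra. Qed.

Lemma ramp_from_bound c j t :
  Rabs (ramp_from c j t) <= match j with 0%nat => 1 | 1%nat => 5 | 2%nat => 420 | _ => 10000 end.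
Proof. apply ramp_bound. Qed.

Lemma rate_bound tau j t :
  Rabs (rate tau j t) <= match j with 0%nat => 2 | 1%nat => 5 | 2%nat => 420 | _ => 10000 end.
Proof.
  unfold rate. assert (H := ramp_from_bound (tau + 1) j t).
  destruct j as [|j]; simpl const_jet.
  - apply Rabs_le_between in H. apply Rabs_le. lra.
  - rewrite Rplus_0_l. exact H.
Qed.

Lemma fade_bound tau j t :
  Rabs (fade tau j t) <= match j with 0%nat => 1 | 1%nat => 5 | 2%nat => 420 | _ => 10000 end.
Proof.
  unfold fade. assert (H := ramp_from_bound (tau + 3) j t).
  destruct j as [|j]; simpl const_jet.
  - assert (H' := ramp0_range (t - (tau + 3))). unfold ramp_from. apply Rabs_le. lra.
  - replace (0 + -1 * ramp_from (tau + 3) (S j) t) with (- ramp_from (tau + 3) (S j) t) by ring.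
    rewrite Rabs_Ropp. exact H.
Qed.

Lemma exp_nondecreasing x y : x <= y -> exp x <= exp y.
Proof.
  intros [H| ->]; [left; apply exp_increasing, H|right; reflexivity].
Qed.

Lemma damp_bound k m tau t : 0 <= k -> tau <= t -> 0 <= damp k m tau t <= exp (- m).
Proof.
  intros Hk Ht. unfold damp. split; [left; apply exp_pos|].
  assert (H := ramp_int_ge0 (t - (tau + 1))).
  assert (0 <= k * (t - tau + ramp_int (t - (tau + 1)))) by (apply Rmult_le_pos; lra).
  apply exp_nondecreasing. lra.
Qed.

Lemma amp_bound k m tau f j t : 10000 <= k -> tau <= t -> (j <= 2)%nat ->
  (forall j, Rabs (f j t) <= match j with 0%nat => 1 | 1%nat => 5 | 2%nat => 420 | _ => 10000 end) ->
  Rabs (amp k m tau f j t) <= exp (- m) * (2 * (2 * k) ^ j).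
Proof.
  intros Hk Ht Hj Hf. unfold amp.
  destruct (damp_bound k m tau t ltac:(lra) Ht) as [D1 D2].
  assert (F0 := Hf 0%nat). assert (F1 := Hf 1%nat). assert (F2 := Hf 2%nat).
  assert (R0 := rate_bound tau 0 t). assert (R1 := rate_bound tau 1 t).
  cbv iota in *.
  apply Rabs_mult_le; [rewrite Rabs_pos_eq; assumption|].
  assert (Hk1 : Rabs (- k) <= k) by (rewrite Rabs_Ropp; apply Rabs_const_le; lra).
  assert (Hk2 : Rabs (k ^ 2) <= k ^ 2) by (apply Rabs_const_le; nra).
  assert (Hk3 : Rabs (-2 * k) <= 2 * k).
  { replace (-2 * k) with (- (2 * k)) by ring. apply Rabs_opp_le, Rabs_const_le. lra. }
  destruct j as [|[|[|j]]]; [| | |lia].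
  - simpl. lra.
  - eapply Rle_trans;
      [repeat first [eassumption|apply Rabs_plus_le|apply Rabs_mult_le]|]. simpl. lra.
  - eapply Rle_trans;
      [repeat first [eassumption|apply Rabs_plus_le|apply Rabs_mult_le]|]. simpl. nra.
Qed.

Lemma const_jet1_bound x j z : 1 <= x -> Rabs (const_jet 1 j z) <= x ^ j.
Proof.
  intro Hx. assert (H := pow_R1_Rle x j Hx). destruct j as [|j].
  - simpl. rewrite Rabs_R1. lra.
  - unfold const_jet. rewrite Rabs_R0. lra.
Qed.

(** Each derivative costs a factor [2 k], which is both the larger spatial frequency and the fastest
    decay rate. Two modes with constant 2 each give the factor 4. *)
Lemma step_u_bound k m tau i j l x y t : 10000 <= k -> tau <= t -> (i + j + l <= 2)%nat ->
  Rabs (step_u k m tau i j l x y t) <= 4 * (2 * k) ^ (i + j + l) * exp (- m).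
Proof.
  intros Hk Ht H.
  assert (Hc : Rabs (cos_jet k i x) <= (2 * k) ^ i).
  { eapply Rle_trans; [apply cos_jet_bound; [lra|lia]|]. apply pow_incr. lra. }
  eapply Rle_trans.
  - apply (sep_sum_bound _ _ _ _ _ _ i j l x y t _ _ _ _ _ _ Hc
      (const_jet1_bound (2 * k) j y ltac:(lra))
      (amp_bound k m tau _ l t Hk Ht ltac:(lia) (fun j => fade_bound tau j t))
      (const_jet1_bound (2 * k) i x ltac:(lra))
      (cos_jet_bound (2 * k) j y ltac:(lra) ltac:(lia))
      (amp_bound k m tau _ l t Hk Ht ltac:(lia) (fun j => ramp_from_bound (tau + 2) j t))).
  - rewrite !pow_add. right. ring.
Qed.

(** For [k >= 10000], [4 k * 5 + 420] is at most [21 k] and [4 k * 420 + 10000] at most [k^2]. Being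
    [O(1/k)], the perturbation keeps bounded derivatives in [x] and [y] although it oscillates at
    frequencies [k] and [2 k]. *)
Lemma pert_bound k c e j t : 10000 <= k -> Rabs e <= / k ^ 2 -> (j <= 1)%nat ->
  Rabs (pert k c e j t) <= match j with 0%nat => 21 / k | _ => 1 end.
Proof.
  intros Hk He Hj. unfold pert.
  assert (P1 := ramp_from_bound c 1 t). assert (P2 := ramp_from_bound c 2 t).
  assert (P3 := ramp_from_bound c 3 t). cbv iota in *.
  assert (Hk1 : Rabs (4 * k) <= 4 * k) by (apply Rabs_const_le; lra).
  assert (Hm : Rabs (-1) <= 1) by (apply Rabs_le; lra).
  destruct j as [|[|j]]; [| |lia]; simpl Nat.add; cbv iota.
  - eapply Rle_trans;
      [repeat first [eassumption|apply Rabs_plus_le|apply Rabs_mult_le]|].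
    replace (21 / k) with (/ k ^ 2 * (21 * k)) by (field; lra).
    apply Rmult_le_compat_l; [left; apply Rinv_0_lt_compat; nra|lra].
  - eapply Rle_trans;
      [repeat first [eassumption|apply Rabs_plus_le|apply Rabs_mult_le]|].
    replace 1 with (/ k ^ 2 * k ^ 2) at 2 by (field; lra).
    apply Rmult_le_compat_l; [left; apply Rinv_0_lt_compat; nra|nra].
Qed.

(** All four entries have this form. The derivatives in [x], [y], [t] are at most 21, 42 and 45 + 1,
    hence below 61. *)
Lemma C1_at_pert k c e c0 r q x y t : 10000 <= k -> Rabs e <= / k ^ 2 -> Rabs c0 <= 1 ->
  (forall k, jets 1 (q k)) -> jets 1 r ->
  (forall k j x, 0 <= k -> (j <= 2)%nat -> Rabs (q k j x) <= k ^ j) ->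
  Rabs (r 0%nat t) <= 5 -> Rabs (r 1%nat t) <= 45 ->
  C1_at (sep_sum (const_jet c0) (const_jet c0) r (q k) (q (2 * k)) (pert k c e) 0 0 0) 61 x y t.
Proof.
  intros Hk He Hc0 Hq Hr Bq Hr0 Hr1.
  assert (P0 := pert_bound k c e 0 t Hk He ltac:(lia)).
  assert (P1 := pert_bound k c e 1 t Hk He ltac:(lia)). cbv iota in *.
  assert (Z : forall z, Rabs (const_jet c0 1 z) <= 0) by (intro; simpl; rewrite Rabs_R0; lra).
  assert (Q := fun j x => Bq k j x ltac:(lra)). assert (Q' := fun j x => Bq (2 * k) j x ltac:(lra)).
  apply C1_at_sep_sum.
  - apply sep_jets_pert; assumption.
  - eapply Rle_trans; [apply (sep_sum_bound _ _ _ _ _ _ 1 0 0 x y t _ _ _ _ _ _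
      (Z x) Hc0 Hr0 (Q 1%nat x ltac:(lia)) (Q' 0%nat y ltac:(lia)) P0)|].
    replace (k ^ 1 * (2 * k) ^ 0 * (21 / k)) with 21 by (simpl; field; lra). lra.
  - eapply Rle_trans; [apply (sep_sum_bound _ _ _ _ _ _ 0 1 0 x y t _ _ _ _ _ _
      Hc0 (Z y) Hr0 (Q 0%nat x ltac:(lia)) (Q' 1%nat y ltac:(lia)) P0)|].
    replace (k ^ 0 * (2 * k) ^ 1 * (21 / k)) with 42 by (simpl; field; lra). lra.
  - eapply Rle_trans; [apply (sep_sum_bound _ _ _ _ _ _ 0 0 1 x y t _ _ _ _ _ _
      Hc0 Hc0 Hr1 (Q 0%nat x ltac:(lia)) (Q' 0%nat y ltac:(lia)) P1)|].
    simpl. lra.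
Qed.

Lemma ratio_small k mu : 10000 + Rabs mu <= k -> Rabs (mu / k ^ 2) <= 1 / 10000.
Proof.
  intro H. assert (H0 := Rabs_pos mu).
  unfold Rdiv at 1. rewrite Rabs_mult, (Rabs_pos_eq (/ k ^ 2)).
  - apply (Rmult_le_reg_r (k ^ 2)); [nra|].
    rewrite Rmult_assoc, Rinv_l by nra. nra.
  - left. apply Rinv_0_lt_compat. nra.
Qed.

(** Up to small terms the entry is [rate^2], which lies between 1 and 4, and after time [tau + 4] it
    descends from 4 to 1. *)
Lemma base0_range k mu tau t : 10000 + Rabs mu <= k -> 1 / 2 <= base k mu tau 0 t <= 5.
Proof.
  intro Hk. assert (Hw := ratio_small k mu Hk). assert (H0 := Rabs_pos mu).
  assert (Hik : 0 < / k <= 1 / 10000).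
  { split; [apply Rinv_0_lt_compat; lra|].
    unfold Rdiv. rewrite Rmult_1_l. apply Rinv_le_contravar; lra. }
  unfold base. set (w := mu / k ^ 2) in *. apply Rabs_le_between in Hw.
  assert (R1 := rate_bound tau 1 t). cbv iota in R1. apply Rabs_le_between in R1.
  destruct (Rle_dec t (tau + 4)) as [Ht|Ht].
  - unfold ramp_from. rewrite (ramp_low 0) by lra.
    assert (Hr := ramp0_range (t - (tau + 1))).
    assert (R0 : 1 <= rate tau 0 t <= 2) by (unfold rate, ramp_from; simpl const_jet; lra).
    assert (1 <= rate tau 0 t * rate tau 0 t <= 4) by nra.
    assert (-(5 / 10000) <= - / k * rate tau 1 t <= 5 / 10000) by (split; nra).
    lra.
  - unfold rate, ramp_from. simpl const_jet.
    rewrite !(ramp_high _ (t - (tau + 1))) by lra.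
    assert (Hr := ramp0_range (t - (tau + 4))). set (r := ramp 0 (t - (tau + 4))) in *.
    set (v := 3 + 15 / 16 * w) in *. assert (Hv : v = 3 + 15 / 16 * w) by reflexivity.
    clearbody v r.
    assert (0 <= v * r) by (apply Rmult_le_pos; lra).
    assert (v * r <= v * 1) by (apply Rmult_le_compat_l; lra).
    simpl. lra.
Qed.

(** The squared rate contributes [2 * 2 * 5], the final reset at most [4 * 5], and the term
    [420 / k] is below 1. *)
Lemma base1_bound k mu tau t : 10000 + Rabs mu <= k -> Rabs (base k mu tau 1 t) <= 45.
Proof.
  intro Hk. assert (Hw := ratio_small k mu Hk). assert (H0 := Rabs_pos mu).
  assert (Hik : 0 < / k <= 1 / 10000).
  { split; [apply Rinv_0_lt_compat; lra|].
    unfold Rdiv. rewrite Rmult_1_l. apply Rinv_le_contravar; lra. }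
  unfold base. set (w := mu / k ^ 2) in *.
  assert (R0 := rate_bound tau 0 t). assert (R1 := rate_bound tau 1 t).
  assert (R2 := rate_bound tau 2 t). assert (P := ramp_from_bound (tau + 4) 1 t). cbv iota in *.
  assert (Hi : Rabs (- / k) <= 1 / 10000).
  { apply Rabs_opp_le. rewrite Rabs_pos_eq; lra. }
  assert (Hc : Rabs (- (3 + 15 / 16 * w)) <= 4).
  { apply Rabs_le_between in Hw. apply Rabs_le. lra. }
  assert (H2 : Rabs 2 <= 2) by (apply Rabs_const_le; lra).
  eapply Rle_trans;
    [repeat first [eassumption|apply Rabs_plus_le|apply Rabs_mult_le]|]. lra.
Qed.

(** The off-diagonal part of the form is at most [(p^2 + q^2) / 50], which is small against the
    diagonal. *)
Lemma elliptic_of_bounds (a b c d : R -> R -> R -> R) x y t :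
  1 / 2 - 1 / 100 <= a x y t <= 6 -> 1 / 2 - 1 / 100 <= d x y t <= 6 ->
  Rabs (b x y t) <= 1 / 100 -> Rabs (c x y t) <= 1 / 100 ->
  elliptic_at a b c d 100 x y t.
Proof.
  intros Ha Hd Hb Hc p q.
  set (A := a x y t) in *. set (B := b x y t) in *. set (C := c x y t) in *.
  set (D := d x y t) in *. clearbody A B C D.
  assert (Hbc : Rabs (B + C) <= 1 / 50).
  { replace (1 / 50) with (1 / 100 + 1 / 100) by field. apply Rabs_plus_le; assumption. }
  assert (Hpq : Rabs (p * q) <= p ^ 2 + q ^ 2).
  { apply Rabs_le. assert (0 <= (p + q) ^ 2) by apply pow2_ge_0.
    assert (0 <= (p - q) ^ 2) by apply pow2_ge_0.
    assert (0 <= p ^ 2) by apply pow2_ge_0. assert (0 <= q ^ 2) by apply pow2_ge_0. nra. }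
  assert (HX := Rabs_mult_le _ _ _ _ Hbc Hpq). apply Rabs_le_between in HX.
  assert (0 <= p ^ 2) by apply pow2_ge_0. assert (0 <= q ^ 2) by apply pow2_ge_0.
  assert (E : p * (A * p + B * q) + q * (C * p + D * q)
    = A * p ^ 2 + D * q ^ 2 + (B + C) * (p * q)) by ring.
  rewrite E. split; nra.
Qed.

Lemma step_solves k m tau mu M t : 10000 + Rabs mu <= k -> tau <= t ->
  16 * k ^ 2 * exp (- m) <= M ->
  solves_at (step_a k mu tau 0 0 0) (step_b k tau 0 0 0) (step_c k tau 0 0 0)
    (step_d k mu tau 0 0 0) (step_u k m tau 0 0 0) mu 100 61 M t.
Proof.
  intros Hmu Ht HM x y. assert (Hw := ratio_small k mu Hmu). assert (H0 := Rabs_pos mu).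
  assert (Hk : 10000 <= k) by lra.
  assert (Hk2 : 0 < / k ^ 2) by (apply Rinv_0_lt_compat; nra).
  assert (E1 : Rabs (/ k ^ 2) <= / k ^ 2) by (apply Rabs_const_le; lra).
  assert (E2 : Rabs (- / k ^ 2) <= / k ^ 2) by (apply Rabs_opp_le, E1).
  assert (E3 : Rabs (/ (4 * k ^ 2)) <= / k ^ 2).
  { rewrite Rinv_mult. rewrite Rabs_pos_eq by nra. nra. }
  assert (Z : Rabs 0 <= 1) by (rewrite Rabs_R0; lra).
  assert (O : Rabs 1 <= 1) by (rewrite Rabs_R1; lra).
  assert (Hw4 : mu / (4 * k ^ 2) = 1 / 4 * (mu / k ^ 2)) by (field; lra).
  assert (Hwb := proj1 (Rabs_le_between _ _) Hw).
  assert (Hc : forall k, jets 1 (cos_jet k)) by (intro; apply jets_cos; lia).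
  assert (Hs : forall k, jets 1 (sin_jet k)) by (intro; apply jets_sin; lia).
  (* The oscillating part of every entry is at most [21 / k], hence below 1/100. *)
  assert (Sm : forall q c e, (forall k j x, 0 <= k -> (j <= 2)%nat -> Rabs (q k j x) <= k ^ j) ->
    Rabs e <= / k ^ 2 -> Rabs (q k 0%nat x * q (2 * k) 0%nat y * pert k c e 0 t) <= 1 / 100).
  { intros q c e Hq He.
    eapply Rle_trans; [apply Rabs_mult_le; [apply Rabs_mult_le; apply Hq; [lra|lia|lra|lia]
      |apply (pert_bound k c e 0 t Hk He); lia]|].
    simpl. apply (Rmult_le_reg_r k); [lra|]. field_simplify; lra. }
  assert (B0 := base0_range k mu tau t Hmu).
  split; [|split; [|split; [|split; [|split; [|split]]]]].
  - assert (S1 := Sm cos_jet (tau + 2) (- / k ^ 2) cos_jet_bound E2). apply Rabs_le_between in S1.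
    assert (S2 := Sm cos_jet (tau + 3) (/ (4 * k ^ 2)) cos_jet_bound E3). apply Rabs_le_between in S2.
    apply elliptic_of_bounds.
    + unfold step_a, sep_sum. unfold const_jet. lra.
    + unfold step_d, sep_sum. unfold const_jet. rewrite Hw4. lra.
    + unfold step_b, sep_sum. unfold const_jet. rewrite !Rmult_0_l, Rplus_0_l.
      apply Sm; [apply sin_jet_bound|exact E1].
    + unfold step_c, sep_sum. unfold const_jet. rewrite !Rmult_0_l, Rplus_0_l.
      apply Sm; [apply sin_jet_bound|exact E2].
  - apply C1_at_pert; auto using jets_base, cos_jet_bound, base1_bound.
    apply Rabs_le. lra.
  - apply C1_at_pert; auto using jets_const, sin_jet_bound; simpl; rewrite Rabs_R0; lra.
  - apply C1_at_pert; auto using jets_const, sin_jet_bound; simpl; rewrite Rabs_R0; lra.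
  - apply C1_at_pert; auto using jets_const, cos_jet_bound; unfold const_jet.
    + rewrite Hw4. apply Rabs_le. lra.
    + rewrite Rabs_R0; lra.
  - apply C2_at_sep_sum; [apply sep_jets_u|]. intros i j l Hijl.
    eapply Rle_trans; [apply (step_u_bound k m tau i j l x y t Hk Ht Hijl)|].
    eapply Rle_trans; [|exact HM]. apply Rmult_le_compat_r; [left; apply exp_pos|].
    replace (16 * k ^ 2) with (4 * (2 * k) ^ 2) by ring.
    apply Rmult_le_compat_l; [lra|]. apply Rle_pow; [lra|lia].
  - apply step_equation. lra.
Qed.

(** * Matching consecutive steps *)

Lemma step_a_junction k mu tau x y t : 0 < k -> tau + 5 <= t <= tau + 7 ->
  step_a k mu tau 0 0 0 x y t = step_d (2 * k) mu (tau + 6) 0 0 0 y x t.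
Proof.
  intros Hk Ht. unfold step_a, step_d, sep_sum, base, pert, rate, ramp_from, const_jet. simpl Nat.add.
  (* In this window every ramp of the old step is complete and none of the next has started; both
     sides are the constant [1 + mu / (4 k)^2]. *)
  rewrite !(ramp_high _ (t - (tau + 1))), !(ramp_high _ (t - (tau + 2))),
    !(ramp_high _ (t - (tau + 4))), !(ramp_low _ (t - (tau + 6 + 3))) by lra.
  field. lra.
Qed.

Lemma step_d_junction k mu tau x y t : 0 < k -> tau + 5 <= t <= tau + 7 ->
  step_d k mu tau 0 0 0 x y t = step_a (2 * k) mu (tau + 6) 0 0 0 y x t.
Proof.
  intros Hk Ht. unfold step_a, step_d, sep_sum, base, pert, rate, ramp_from, const_jet. simpl Nat.add.
  rewrite !(ramp_high _ (t - (tau + 3))), !(ramp_low _ (t - (tau + 6 + 1))),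
    !(ramp_low _ (t - (tau + 6 + 2))), !(ramp_low _ (t - (tau + 6 + 4))) by lra.
  field. lra.
Qed.

Lemma step_b_junction k tau x y t : tau + 5 <= t <= tau + 7 ->
  step_b k tau 0 0 0 x y t = step_c (2 * k) (tau + 6) 0 0 0 y x t.
Proof.
  intros Ht. unfold step_b, step_c, sep_sum, pert, ramp_from, const_jet. simpl Nat.add.
  rewrite !(ramp_high _ (t - (tau + 3))), !(ramp_low _ (t - (tau + 6 + 2))) by lra.
  ring.
Qed.

Lemma step_c_junction k tau x y t : tau + 5 <= t <= tau + 7 ->
  step_c k tau 0 0 0 x y t = step_b (2 * k) (tau + 6) 0 0 0 y x t.
Proof.
  intros Ht. unfold step_b, step_c, sep_sum, pert, ramp_from, const_jet. simpl Nat.add.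
  rewrite !(ramp_high _ (t - (tau + 2))), !(ramp_low _ (t - (tau + 6 + 3))) by lra.
  ring.
Qed.

(** A step costs [6 k] at the basic rate plus [(5 - 1/2) k] for the acceleration, in all [21/2 k].
    The surviving mode [cos (2 k y)], which decays at rate [2 k], is the initial mode of the next
    step with the coordinates exchanged. *)
Lemma step_u_junction k m tau x y t : tau + 5 <= t <= tau + 7 ->
  step_u k m tau 0 0 0 x y t = step_u (2 * k) (m + 21 / 2 * k) (tau + 6) 0 0 0 y x t.
Proof.
  intros Ht. unfold step_u, sep_sum, amp, damp, fade, rise, ramp_from, const_jet, cos_jet.
  rewrite !(ramp_high _ (t - (tau + 2))), !(ramp_high _ (t - (tau + 3))),
    !(ramp_low _ (t - (tau + 6 + 2))), !(ramp_low _ (t - (tau + 6 + 3))),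
    (ramp_int_high (t - (tau + 1))), (ramp_int_low (t - (tau + 6 + 1))) by lra.
  replace (- (m + k * (t - tau + (t - (tau + 1) - 1 / 2))))
    with (- (m + 21 / 2 * k + 2 * k * (t - (tau + 6) + 0))) by field.
  ring.
Qed.

(** * Periodicity *)

Lemma cos_jet_periodic n j x : cos_jet (INR n) j (x + 2 * PI) = cos_jet (INR n) j x.
Proof.
  unfold cos_jet. replace (INR n * (x + 2 * PI)) with (INR n * x + 2 * INR n * PI) by ring.
  rewrite cos_period, sin_period. reflexivity.
Qed.

Lemma sin_jet_periodic n j x : sin_jet (INR n) j (x + 2 * PI) = sin_jet (INR n) j x.
Proof.
  unfold sin_jet. replace (INR n * (x + 2 * PI)) with (INR n * x + 2 * INR n * PI) by ring.
  rewrite cos_period, sin_period. reflexivity.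
Qed.

Lemma sep_sum_periodic p1 q1 r1 p2 q2 r2 i j l :
  (forall j x, p1 j (x + 2 * PI) = p1 j x) -> (forall j x, q1 j (x + 2 * PI) = q1 j x) ->
  (forall j x, p2 j (x + 2 * PI) = p2 j x) -> (forall j x, q2 j (x + 2 * PI) = q2 j x) ->
  periodic2 (sep_sum p1 q1 r1 p2 q2 r2 i j l).
Proof.
  intros H1 H2 H3 H4 x y t. unfold sep_sum. rewrite H1, H2, H3, H4. split; reflexivity.
Qed.

Lemma periodic2_swap f : periodic2 f -> periodic2 (swap f).
Proof. intros H x y t. destruct (H y x t). split; assumption. Qed.

(** * Gluing the steps in time *)

Definition step_index (t : R) : nat := Z.to_nat (Int_part (t / 6)).

Lemma step_index_unique n t : 6 * INR n <= t < 6 * INR (S n) -> step_index t = n.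
Proof.
  intros H. rewrite S_INR in H. unfold step_index.
  rewrite <- (Int_part_spec (t / 6) (Z.of_nat n)); [apply Nat2Z.id|].
  rewrite <- INR_IZR_INZ. lra.
Qed.

(** [Z.to_nat] sends negative integers to 0, so the first step also covers negative times, which
    gives a full slab around time 0. *)
Lemma step_index_neg t : t < 0 -> step_index t = 0%nat.
Proof.
  intros H. unfold step_index. destruct (base_Int_part (t / 6)) as [H1 _].
  assert (IZR (Int_part (t / 6)) < 0) by lra. apply lt_IZR in H0. lia.
Qed.

Lemma step_index_spec t : 0 <= t ->
  6 * INR (step_index t) <= t < 6 * INR (S (step_index t)).
Proof.
  intros H. rewrite S_INR. unfold step_index.
  destruct (base_Int_part (t / 6)) as [H1 H2].
  assert (Hp : (-1 < Int_part (t / 6))%Z) by (apply lt_IZR; lra).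
  rewrite INR_IZR_INZ, Z2Nat.id by lia. lra.
Qed.

Definition glue (F : nat -> R -> R -> R -> R) : R -> R -> R -> R :=
  fun x y t => F (step_index t) x y t.

(** A slab of radius 1 meets at most one junction, and there the two neighbouring formulas agree for
    one unit of time on either side. So near every time the glued function is given by a single
    formula. *)
Lemma glue_near F t : 0 <= t ->
  (forall n x y s, 6 * INR (S n) - 1 <= s <= 6 * INR (S n) + 1 ->
    F n x y s = F (S n) x y s) ->
  near (glue F) (F (step_index t)) t.
Proof.
  intros Ht HF. assert (Hn := step_index_spec t Ht).
  set (n := step_index t) in *. clearbody n.
  exists 1. split; [lra|]. intros x y s Hs. unfold glue.
  apply Rabs_lt_between in Hs.
  destruct (Rlt_dec s (6 * INR n)) as [H1|H1].
  - destruct n as [|n].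
    + rewrite step_index_neg by (simpl in H1; lra). reflexivity.
    + rewrite (step_index_unique n); [apply HF; lra|].
      split; [|exact H1]. rewrite S_INR in Hn. lra.
  - destruct (Rlt_dec s (6 * INR (S n))) as [H2|H2].
    + rewrite (step_index_unique n) by lra. reflexivity.
    + rewrite (step_index_unique (S n)); [symmetry; apply HF; lra|].
      rewrite (S_INR (S n)). lra.
Qed.

Lemma glue_periodic F : (forall n, periodic2 (F n)) -> periodic2 (glue F).
Proof. intros H x y t. apply (H (step_index t)). Qed.

(* The roles of [x] and [y] are exchanged in the odd steps. *)
Definition alternate (n : nat) (f g : R -> R -> R -> R) : R -> R -> R -> R :=
  if Nat.even n then f else swap g.

(** The first hypothesis serves the passage from an even step to an odd one, the second the passage
    back. *)
Lemma alternate_junction n f g f' g' x y t :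
  (forall x y, f x y t = g' y x t) -> (forall x y, g x y t = f' y x t) ->
  alternate n f g x y t = alternate (S n) f' g' x y t.
Proof.
  intros H1 H2. unfold alternate. rewrite Nat.even_succ, <- Nat.negb_even.
  destruct (Nat.even n); simpl; unfold swap; auto.
Qed.

Lemma alternate_periodic n f g : periodic2 f -> periodic2 g -> periodic2 (alternate n f g).
Proof.
  intros Hf Hg. unfold alternate. destruct (Nat.even n); auto using periodic2_swap.
Qed.

Lemma alternate_solves n a b c d u mu Lam C M t :
  solves_at a b c d u mu Lam C M t ->
  solves_at (alternate n a d) (alternate n b c) (alternate n c b) (alternate n d a)
    (alternate n u u) mu Lam C M t.
Proof.
  intro H. unfold alternate. destruct (Nat.even n); [exact H|apply solves_at_swap, H].
Qed.

(** * The cascade of frequencies and its decay *)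

Definition freq (k0 n : nat) : nat := (k0 * 2 ^ n)%nat.

Lemma freq_S k0 n : INR (freq k0 (S n)) = 2 * INR (freq k0 n).
Proof.
  unfold freq. replace (k0 * 2 ^ S n)%nat with (2 * (k0 * 2 ^ n))%nat by (simpl; ring).
  rewrite mult_INR. reflexivity.
Qed.

Lemma freq_0 k0 : freq k0 0 = k0.
Proof. unfold freq. simpl. ring. Qed.

Lemma freq_ge k0 n : (k0 <= freq k0 n)%nat.
Proof. unfold freq. assert (2 ^ n <> 0)%nat by (apply Nat.pow_nonzero; lia). nia. Qed.

Lemma freq_pow k0 n : (0 < k0)%nat -> 2 ^ n <= INR (freq k0 n).
Proof.
  intro H. unfold freq. rewrite mult_INR, pow_INR. change (INR 2) with 2.
  assert (1 <= INR k0) by (apply (le_INR 1); lia).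
  assert (0 < 2 ^ n) by (apply pow_lt; lra). nra.
Qed.

(* [exp (- loss k0 n)] is the amplitude at time [6 n]: a step at frequency [k] costs [21/2 k],
   and the frequencies double. *)
Definition loss (k0 n : nat) : R := 21 / 2 * (INR (freq k0 n) - INR k0).

Definition fam_a k0 mu n := alternate n
  (step_a (INR (freq k0 n)) mu (6 * INR n) 0 0 0) (step_d (INR (freq k0 n)) mu (6 * INR n) 0 0 0).
Definition fam_d k0 mu n := alternate n
  (step_d (INR (freq k0 n)) mu (6 * INR n) 0 0 0) (step_a (INR (freq k0 n)) mu (6 * INR n) 0 0 0).
Definition fam_b k0 n := alternate n
  (step_b (INR (freq k0 n)) (6 * INR n) 0 0 0) (step_c (INR (freq k0 n)) (6 * INR n) 0 0 0).
Definition fam_c k0 n := alternate n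
  (step_c (INR (freq k0 n)) (6 * INR n) 0 0 0) (step_b (INR (freq k0 n)) (6 * INR n) 0 0 0).
Definition fam_u k0 n := alternate n
  (step_u (INR (freq k0 n)) (loss k0 n) (6 * INR n) 0 0 0)
  (step_u (INR (freq k0 n)) (loss k0 n) (6 * INR n) 0 0 0).

Lemma INR_double n : 2 * INR n = INR (2 * n).
Proof. rewrite mult_INR. reflexivity. Qed.

Lemma pert_sep_sum_periodic n q c0 r k c e i j l :
  (forall n j x, q (INR n) j (x + 2 * PI) = q (INR n) j x) ->
  periodic2 (sep_sum (const_jet c0) (const_jet c0) r (q (INR n)) (q (2 * INR n)) (pert k c e) i j l).
Proof.
  intro Hq. rewrite INR_double. apply sep_sum_periodic; intros; try apply Hq; reflexivity.
Qed.

Lemma step_u_periodic n m tau i j l : periodic2 (step_u (INR n) m tau i j l).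
Proof.
  unfold step_u. rewrite INR_double.
  apply sep_sum_periodic; intros; try apply cos_jet_periodic; reflexivity.
Qed.

Lemma fam_near k0 mu t : (0 < k0)%nat -> 0 <= t ->
  near (glue (fam_a k0 mu)) (fam_a k0 mu (step_index t)) t /\
  near (glue (fam_b k0)) (fam_b k0 (step_index t)) t /\
  near (glue (fam_c k0)) (fam_c k0 (step_index t)) t /\
  near (glue (fam_d k0 mu)) (fam_d k0 mu (step_index t)) t /\
  near (glue (fam_u k0)) (fam_u k0 (step_index t)) t.
Proof.
  intros Hk0 Ht.
  assert (Hk : forall n, 0 < INR (freq k0 n)).
  { intro n. apply lt_0_INR. assert (H := freq_ge k0 n). lia. }
  assert (Htau : forall n, 6 * INR (S n) = 6 * INR n + 6) by (intro; rewrite S_INR; ring).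
  assert (Hm : forall n, loss k0 (S n) = loss k0 n + 21 / 2 * INR (freq k0 n)).
  { intro n. unfold loss. rewrite freq_S. ring. }
  repeat split; (apply glue_near; [exact Ht|]); intros n x y s Hs;
    unfold fam_a, fam_b, fam_c, fam_d, fam_u; rewrite ?Hm, Htau, freq_S in *;
    apply alternate_junction; intros x' y'.
  - apply step_a_junction; [apply Hk|lra].
  - apply step_d_junction; [apply Hk|lra].
  - apply step_b_junction; lra.
  - apply step_c_junction; lra.
  - apply step_c_junction; lra.
  - apply step_b_junction; lra.
  - apply step_d_junction; [apply Hk|lra].
  - apply step_a_junction; [apply Hk|lra].
  - apply step_u_junction; lra.
  - apply step_u_junction; lra.
Qed.

(** Two derivatives cost [k^2], and [exp (21/2 k) >= (exp k)^2 >= k^2]. This makes the [C^2] bound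
    uniform over the steps. *)
Lemma sqr_exp_loss k0 n :
  INR (freq k0 n) ^ 2 * exp (- loss k0 n) <= exp (21 / 2 * INR k0).
Proof.
  unfold loss. set (k := INR (freq k0 n)). assert (Hk : 0 <= k) by apply pos_INR.
  replace (- (21 / 2 * (k - INR k0))) with (21 / 2 * INR k0 + - (21 / 2 * k)) by ring.
  rewrite exp_plus.
  assert (H1 : 1 + k <= exp k) by apply exp_ineq1_le.
  assert (H2 : exp (k + k) <= exp (21 / 2 * k)) by (apply exp_nondecreasing; lra).
  rewrite exp_plus in H2. rewrite exp_Ropp.
  assert (H3 := exp_pos (21 / 2 * k)). assert (H4 := exp_pos (21 / 2 * INR k0)).
  apply (Rmult_le_reg_r (exp (21 / 2 * k))); [exact H3|].
  replace (k ^ 2 * (exp (21 / 2 * INR k0) * / exp (21 / 2 * k)) * exp (21 / 2 * k))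
    with (exp (21 / 2 * INR k0) * k ^ 2) by (field; lra).
  apply Rmult_le_compat_l; [lra|]. nra.
Qed.

(** By induction from [exp (1/2) <= 2], which holds because [exp 1 <= 3]. *)
Lemma exp_half_pow n : exp (INR n / 2) <= 2 ^ n.
Proof.
  induction n as [|n IH].
  - simpl. unfold Rdiv. rewrite Rmult_0_l, exp_0. lra.
  - rewrite S_INR. replace ((INR n + 1) / 2) with (/ 2 + INR n / 2) by field.
    rewrite exp_plus. simpl.
    assert (H : exp (/ 2) <= 2).
    { assert (H := exp_le_3). replace 1 with (/ 2 + / 2) in H by field.
      rewrite exp_plus in H. assert (H' := exp_pos (/ 2)). nra. }
    apply Rmult_le_compat; auto; left; apply exp_pos.
Qed.

(** The loss grows like [2^n], while [T <= t < 6 (n + 1)] gives [exp (T / 12) <= exp ((n + 1) / 2)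
    <= 2^(n + 1)]; hence the constant 1/12. The factor [exp (21/2 k0)] accounts for the [k0]
    subtracted in [loss]. *)
Lemma fam_u_decay k0 x y t T : 10000 <= INR k0 -> 0 <= t -> T <= t ->
  Rabs (glue (fam_u k0) x y t)
    <= 4 * exp (21 / 2 * INR k0) * exp (- (1 / 12) * exp (1 / 12 * T)).
Proof.
  intros Hk0 Ht HT. unfold glue. assert (Hn := step_index_spec t Ht).
  set (n := step_index t) in *. clearbody n.
  assert (Hk : 10000 <= INR (freq k0 n)).
  { assert (H := le_INR _ _ (freq_ge k0 n)). lra. }
  assert (B : forall x y, Rabs (step_u (INR (freq k0 n)) (loss k0 n) (6 * INR n) 0 0 0 x y t)
    <= 4 * exp (- loss k0 n)).
  { intros x' y'. eapply Rle_trans; [apply step_u_bound; [exact Hk|lra|lia]|]. simpl. lra. }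
  apply (Rle_trans _ (4 * exp (- loss k0 n))).
  { unfold fam_u, alternate. destruct (Nat.even n); apply B. }
  rewrite Rmult_assoc, <- exp_plus. apply Rmult_le_compat_l; [lra|].
  apply exp_nondecreasing. unfold loss.
  assert (H1 : exp (1 / 12 * T) <= 2 ^ S n).
  { eapply Rle_trans; [|apply exp_half_pow]. apply exp_nondecreasing. lra. }
  assert (H2 : 2 ^ n <= INR (freq k0 n)).
  { apply freq_pow. apply INR_lt. simpl. lra. }
  simpl in H1. lra.
Qed.

Theorem mainTheorem5 (mu : R) :
  exists (a b c d u : R -> R -> R -> R),
    reg_class a b c d 100 61 /\
    periodic2 u /\ uniformly_C2 u /\
    (exists x y t, 0 <= t /\ u x y t <> 0) /\
    (forall x y t, 0 < t -> wave_op a b c d u x y t = - mu * u x y t) /\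
    (exists cc CC T0, 0 < cc /\ 0 < CC /\
       forall T, T0 <= T -> forall x y t, T <= t ->
         Rabs (u x y t) <= CC * exp (- cc * exp (cc * T))) /\
    (exists k : nat, (0 < k)%nat /\ Rabs mu / (INR k) ^ 2 <= 1 / 1000 /\
       forall x y t, 0 <= t <= 1 / 100 ->
         u x y t = cos (INR k * x) * exp (- INR k * t) /\
         a x y t = 1 + mu / (INR k) ^ 2 /\ b x y t = 0 /\
         c x y t = 0 /\ d x y t = 1 + mu / (4 * (INR k) ^ 2)).
Proof.
  (* One choice of [k0] serves every step, since the frequencies only grow: 10000 dominates the ramp
     constants, and [|mu|] makes [mu / k^2] small. *)
  destruct (INR_unbounded (10000 + Rabs mu)) as [k0 Hk0].
  assert (Hmu := Rabs_pos mu).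
  assert (Hpos : (0 < k0)%nat) by (apply INR_lt; simpl; lra).
  assert (Hk : forall n, 10000 + Rabs mu <= INR (freq k0 n)).
  { intro n. assert (H := le_INR _ _ (freq_ge k0 n)). lra. }
  assert (Hs : forall t, 0 <= t -> solves_at (glue (fam_a k0 mu)) (glue (fam_b k0))
    (glue (fam_c k0)) (glue (fam_d k0 mu)) (glue (fam_u k0)) mu 100 61
    (16 * exp (21 / 2 * INR k0)) t).
  { intros t Ht. destruct (fam_near k0 mu t Hpos Ht) as (Na & Nb & Nc & Nd & Nu).
    apply (solves_at_near _ _ _ _ _ _ _ _ _ _ _ _ _ _ _ Na Nb Nc Nd Nu).
    assert (Hn := step_index_spec t Ht).
    apply alternate_solves, step_solves; [apply Hk|lra|].
    rewrite Rmult_assoc. apply Rmult_le_compat_l; [lra|apply sqr_exp_loss]. }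
  (* No ramp starts before time 1, so the initial formulas are still exact on [0, 1/100]. *)
  assert (Hinit : forall x y t, 0 <= t <= 1 / 100 ->
    glue (fam_u k0) x y t = cos (INR k0 * x) * exp (- INR k0 * t) /\
    glue (fam_a k0 mu) x y t = 1 + mu / (INR k0) ^ 2 /\ glue (fam_b k0) x y t = 0 /\
    glue (fam_c k0) x y t = 0 /\ glue (fam_d k0 mu) x y t = 1 + mu / (4 * (INR k0) ^ 2)).
  { intros x y t Ht. unfold glue. rewrite (step_index_unique 0) by (simpl; lra).
    unfold fam_u, fam_a, fam_b, fam_c, fam_d, alternate. simpl (Nat.even 0). cbv iota.
    unfold step_u, step_a, step_b, step_c, step_d, sep_sum, amp, damp, base, pert, fade, rise, rate,
      ramp_from, const_jet, cos_jet, loss.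
    rewrite freq_0. simpl Nat.add. simpl (INR 0).
    rewrite !(ramp_low _ (t - (6 * 0 + 1))), !(ramp_low _ (t - (6 * 0 + 2))),
      !(ramp_low _ (t - (6 * 0 + 3))), !(ramp_low _ (t - (6 * 0 + 4))),
      ramp_int_low by lra.
    replace (- (21 / 2 * (INR k0 - INR k0) + INR k0 * (t - 6 * 0 + 0)))
      with (- INR k0 * t) by ring.
    repeat split; ring. }
  exists (glue (fam_a k0 mu)), (glue (fam_b k0)), (glue (fam_c k0)), (glue (fam_d k0 mu)),
    (glue (fam_u k0)).
  split; [|split; [|split; [|split; [|split; [|split]]]]].
  - assert (Pa : forall n, periodic2 (step_a (INR (freq k0 n)) mu (6 * INR n) 0 0 0))
      by (intro; apply pert_sep_sum_periodic, cos_jet_periodic).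
    assert (Pb : forall n, periodic2 (step_b (INR (freq k0 n)) (6 * INR n) 0 0 0))
      by (intro; apply pert_sep_sum_periodic, sin_jet_periodic).
    assert (Pc : forall n, periodic2 (step_c (INR (freq k0 n)) (6 * INR n) 0 0 0))
      by (intro; apply pert_sep_sum_periodic, sin_jet_periodic).
    assert (Pd : forall n, periodic2 (step_d (INR (freq k0 n)) mu (6 * INR n) 0 0 0))
      by (intro; apply pert_sep_sum_periodic, cos_jet_periodic).
    do 4 (split; [apply glue_periodic; intro; apply alternate_periodic; auto|]).
    split; [intros x y t Ht; apply (Hs t Ht x y)|].
    split; [|split; [|split]]; intros x y t Ht; apply (Hs t ltac:(lra) x y).
  - apply glue_periodic. intro n. apply alternate_periodic; apply step_u_periodic.
  - exists (16 * exp (21 / 2 * INR k0)). intros x y t Ht.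
    apply (Hs t ltac:(lra) x y).
  - exists 0, 0, 0. split; [lra|]. rewrite (proj1 (Hinit 0 0 0 ltac:(lra))).
    rewrite !Rmult_0_r, cos_0, exp_0. lra.
  - intros x y t Ht. apply (Hs t ltac:(lra) x y).
  - exists (1 / 12), (4 * exp (21 / 2 * INR k0)), 0.
    split; [lra|]. split; [assert (H := exp_pos (21 / 2 * INR k0)); lra|].
    intros T HT x y t Ht. apply fam_u_decay; lra.
  - exists k0. split; [exact Hpos|]. split; [|exact Hinit].
    rewrite <- (freq_0 k0). assert (H := ratio_small _ _ (Hk 0%nat)).
    unfold Rdiv in H at 1. rewrite Rabs_mult, (Rabs_pos_eq (/ _)) in H.
    + unfold Rdiv at 1. lra.
    + left. apply Rinv_0_lt_compat. specialize (Hk 0%nat). nra.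
Qed.
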